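(* For every $n\in\mathbb{N}=\{1,2,\dots\}$, the output of the Enumeration Algorithm (described in the context) on input $n$ is precisely the collection of inverse semigroups of order $n$ up to isomorphism. That is, every semigroup output is an inverse semigroup of order $n$, no two semigroups output are isomorphic, and every inverse semigroup of order $n$ is isomorphic to one of the semigroups output.
   Context: An inverse semigroup is a nonempty semigroup $S$ in which each $x$ has a unique $x^{-1}$ with $xx^{-1}x=x$ and $x^{-1}xx^{-1}=x^{-1}$. $E(S)$ is its set of idempotents, a meet-semilattice under $e\wedge f=ef$ (so $e\le f\iff e=ef$). Every meet-semilattice below is finite. **Partitions.** A composition of $m$ is a list of positive integers with sum $m$; a partition of $m$ is a weakly decreasing composition; $|\lambda|$ is the number of entries of $\lambda$ and $\lambda_i$ its $i$th entry. The shape of a set partition $\{X_1,\dots,X_k\}$ with $|X_1|\ge\dots\ge|X_k|$ is $(|X_1|,\dots,|X_k|)$. For a partition $\lambda$ of a positive integer, a composition $C$ with $|C|=|\lambda|$ is admissible for $(n,\lambda)$ if $n=\sum_{i=1}^{|\lambda|}\lambda_i^2C_i$. A set partition $P$ of a meet-semilattice $E$, with associated equivalence relation $\sim$, is a $\mathcal D$-partition if whenever $e_1\sim e_2$ and $f\le e_1$ in $E$ we have $|\{h\in E:h\le e_1,\ h\sim f\}|=|\{h\in E:h\le e_2,\ h\sim f\}|$. **Natural basis.** Let $P=(X_1,\dots,X_k)$ be a $\mathcal D$-partition of $E$ and $f$ a function assigning a finite group $f(X_i)$ to each $X_i$. The natural basis $B$ of $A=\bigoplus_{i=1}^k M_{|X_i|}(\mathbb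 C f(X_i))$ (block $i$ indexed by $X_i$) consists of the matrices $g_{a,b}$ ($a,b\in X_i$, $g\in f(X_i)$, $1\le i\le k$) with $g$ in position $(a,b)$ of block $i$ and $0$ elsewhere. Write $()$ for the identity of any group. Put $(g_{a,b})^{-1}=(g^{-1})_{b,a}$, $\mathrm{dom}(b)=b^{-1}b$, $\mathrm{ran}(b)=bb^{-1}$ for $b\in B$. The set of idempotents of $B$ is $E(B)=\{()_{a,a}:a\in E\}$, ordered by $()_{a,a}\le_{E(B)}()_{b,b}\iff a\le b$ in $E$. **ESN conditions** on a partial order $\le$ on $B$: (i) $\le$ restricted to $E(B)$ forms a meet-semilattice; (ii) for all $s,t\in B$, $s\le t$ implies $s^{-1}\le t^{-1}$; (iii) for all $s,t,y,z\in B$, if $s\le y$, $t\le z$, $st\ne0$ and $yz\neq0$, then $st\le yz$; (iv) for all $e,s\in B$, if $e\le\mathrm{dom}(s)$ then there is a unique $t\le s$ with $\mathrm{dom}(t)=e$; (v) for all $e,s\in B$, if $e\le\mathrm{ran}(s)$ then there is a unique $t\le s$ with $\mathrm{ran}(t)=e$. **ESN construction.** For $\le$ satisfying these conditions and $b\in B$, let $\overline b=\sum_{a\in B,\,a\le b}a\in A$. Then $\overline B=\{\overline b:b\in B\}$ is an inverse semigroup under matrix multiplication; $\mathrm{ESN}(B,\le)$ denotes it after renaming $\overline{()_{e,e}}$ as $e$ for all $e\in E$. **Subroutines.** $\mathrm{Groups}(n)$: a set of representatives of the isomorphism classes of groups of order at most $n$. $\mathrm{Partitions}(m)$: the partitions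 of $m$. $\mathrm{MeetSemilattices}(m)$: one representative of each isomorphism class of meet-semilattices of order $m$. $\mathrm{DPartitions}(E,\lambda)$: the $\mathcal D$-partitions of $E$ of shape $\lambda$, each listed once as an ordered tuple $(X_1,\dots,X_k)$ with $|X_1|\ge\dots\ge|X_k|$. $\mathrm{GroupMaps}(P,C,\mathrm{Gn})$: all functions $f:\{X_1,\dots,X_{|C|}\}\to\mathrm{Gn}$ with $|f(X_i)|=C_i$ for all $i$. $\mathrm{GPosets}(B,\le_{E(B)})$: all partial orders on $B$ that satisfy the ESN conditions and restrict to $\le_{E(B)}$ on $E(B)$. $\mathrm{Invariants}(S)$: a tuple $I(S)$ such that $E(S)=E(T)$ and $S\cong T$ imply $I(S)=I(T)$. $\mathrm{IsNew}(S,I,\mathrm{isgs})$, where isgs is a dictionary whose values are lists of inverse semigroups: False if $I$ is a key of isgs and $S$ is isomorphic to some member of $\mathrm{isgs}[I]$; True otherwise. **Enumeration Algorithm**, input $n$. Set $\mathrm{Gn}=\mathrm{Groups}(n)$. For each $m\in\{1,\dots,n\}$: for each $\lambda\in\mathrm{Partitions}(m)$ let $S_\lambda$ be the set of admissible compositions for $(n,\lambda)$. Then for each $E\in\mathrm{MeetSemilattices}(m)$ and each $\lambda\in\mathrm{Partitions}(m)$: start with an empty dictionary isgs; for each $C\in S_\lambda$, each $P=(X_1,\dots,X_k)\in\mathrm{DPartitions}(E,\lambda)$, each $f\in\mathrm{GroupMaps}(P,C,\mathrm{Gn})$, with $B$ the natural basis of $\bigoplus_{i=1}^k M_{|X_i|}(\mathbb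 C f(X_i))$ (block $i$ indexed by $X_i$) and $\le_{E(B)}$ the partial order on $E(B)=\{()_{a,a}:a\in E\}$ given by $()_{a,a}\le_{E(B)}()_{b,b}\iff a\le b$ in $E$, and each $\le$ in $\mathrm{GPosets}(B,\le_{E(B)})$: let $S=\mathrm{ESN}(B,\le)$ and $I=\mathrm{Invariants}(S)$, and if $\mathrm{IsNew}(S,I,\mathrm{isgs})$ is True, append $S$ to $\mathrm{isgs}[I]$ (creating this list if $I$ is not yet a key). After these loops over $C,P,f,\le$ finish, output every semigroup contained in isgs (for the current $E$ and $\lambda$). *)

(* Defs.v *)
From HB Require Import structures.
From Stdlib Require List.
From mathcomp Require Import all_boot all_order all_fingroup all_algebra.
From mathcomp Require Import finmap complex boolp reals.

Set Implicit Arguments.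
Unset Strict Implicit.
Unset Printing Implicit Defensive.

Import Order.TTheory GRing.Theory.
Local Open Scope ring_scope.

Definition representatives (T : Type) (iso : T -> T -> Prop) (P : T -> Prop)
    (s : seq T) : Prop :=
  [/\ forall x, List.In x s -> P x,
      List.ForallOrdPairs (fun x y => ~ iso x y) s
    & forall x, P x -> exists2 y, List.In y s & iso x y].

Definition enumerates (T : eqType) (P : T -> Prop) (s : seq T) : Prop :=
  uniq s /\ forall x, x \in s <-> P x.

(* A finite subset of an ambient magma.  It need not be closed under the
   operation: the elements [bar b] below form a finite subset of an infinite
   algebra, and being a semigroup is a property to be proved of it. *)
Record fmagma := FMagma {
  ambient : choiceType;
  op : ambient -> ambient -> ambient;
  elts : {fset ambient}
}.

Definition order_of (S : fmagma) : nat := #|` elts S|.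

Definition inverse_semigroup (S : fmagma) : Prop :=
  [/\ elts S != fset0,
      {in elts S &, forall x y, op x y \in elts S},
      {in elts S & &, forall x y z, op x (op y z) = op (op x y) z}
    & {in elts S, forall x, exists! y,
        [/\ y \in elts S, op (op x y) x = x & op (op y x) y = y]}].

Definition isomorphic (S T : fmagma) : Prop :=
  exists phi : ambient S -> ambient T,
    [/\ {in elts S &, injective phi},
        [fset phi x | x in elts S]%fset = elts T
      & {in elts S &, {morph phi : x y / op x y >-> op x y}}].

(* The result of renaming some of the elements of a finite magma: the element
   [label e] has been given the name [e : E]. *)
Record named (E : Type) := Named {
  magma_of :> fmagma;
  label : E -> ambient magma_of
}.

Section Semilattices.
Variable d : Order.disp_t.
Local Open Scope order_scope.
Implicit Types E F : finMeetSemilatticeType d.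

Definition semilattice_iso E F : Prop :=
  exists2 phi : E -> F, bijective phi & {morph phi : x y / x `&` y}.

(* E(S) = E as meet-semilattices, once the elements of S have been renamed. *)
Definition idempotents_are E (S : named E) : Prop :=
  [/\ injective (@label E S),
      forall x : ambient S,
        (x \in elts S /\ op x x = x) <-> exists e, x = label S e
    & {morph @label E S : e f / e `&` f >-> op e f}].

Definition shape_of E (P : {set {set E}}) : seq nat :=
  sort geq [seq #|Y| | Y : {set E} <- enum P].

Definition D_partition E (P : {set {set E}}) : Prop :=
  partition P [set: E] /\
  forall e1 e2 f : E, pblock P e1 = pblock P e2 -> f <= e1 ->
    #|[set h : E | (h <= e1) && (pblock P h == pblock P f)]| =
    #|[set h : E | (h <= e2) && (pblock P h == pblock P f)]|.

End Semilattices.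

Definition is_composition (m : nat) (s : seq nat) : bool :=
  all (leq 1) s && (sumn s == m).

Definition is_partition (m : nat) (s : seq nat) : bool :=
  is_composition m s && sorted geq s.

Definition admissible (n : nat) (lam C : seq nat) : bool :=
  [&& all (leq 1) C, size C == size lam
    & n == (\sum_(i < size lam) nth 0 lam i ^ 2 * nth 0 C i)%N].

(* The group algebra K[gT], with the convolution product. *)
Definition galg (K : fieldType) (gT : finGroupType) : Type := {ffun gT -> K}.

Section GroupAlgebra.
Variables (K : fieldType) (gT : finGroupType).

HB.instance Definition _ := Choice.on (galg K gT).
HB.instance Definition _ := GRing.Zmodule.on (galg K gT).

Definition galg_of (g : gT) : galg K gT := [ffun h => (h == g)%:R].

Definition galg_mul (x y : galg K gT) : galg K gT :=
  [ffun g => \sum_(h : gT) x h * y (h^-1 * g)%g].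

Fact galg_mulA : associative galg_mul.
Proof.
move=> x y z; apply/ffunP=> g; rewrite !ffunE.
under eq_bigr do rewrite ffunE mulr_sumr.
under [RHS]eq_bigr do rewrite ffunE mulr_suml.
rewrite [RHS]exchange_big; apply: eq_bigr => h _ /=.
rewrite [RHS](reindex_inj (mulgI h)); apply: eq_bigr => k _ /=.
by rewrite mulrA mulKg invMg mulgA.
Qed.

Fact galg_mul1l : left_id (galg_of 1%g) galg_mul.
Proof.
move=> x; apply/ffunP=> g; rewrite !ffunE (bigD1 1%g) //= ffunE eqxx mul1r.
rewrite invg1 mul1g big1 ?addr0 // => h /negPf h1.
by rewrite ffunE h1 mul0r.
Qed.

Fact galg_mul1r : right_id (galg_of 1%g) galg_mul.
Proof.
move=> x; apply/ffunP=> g; rewrite !ffunE (bigD1 g) //= ffunE mulVg eqxx mulr1.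
rewrite big1 ?addr0 // => h hg; rewrite ffunE -eq_mulVg1 (negPf hg).
by rewrite mulr0.
Qed.

Fact galg_mulDl : left_distributive galg_mul +%R.
Proof.
move=> x y z; apply/ffunP=> g; rewrite !ffunE -big_split.
by apply: eq_bigr => h _; rewrite ffunE mulrDl.
Qed.

Fact galg_mulDr : right_distributive galg_mul +%R.
Proof.
move=> x y z; apply/ffunP=> g; rewrite !ffunE -big_split.
by apply: eq_bigr => h _; rewrite ffunE mulrDr.
Qed.

HB.instance Definition _ := GRing.Zmodule_isPzRing.Build (galg K gT)
  galg_mulA galg_mul1l galg_mul1r galg_mulDl galg_mulDr.

End GroupAlgebra.

Definition dsum (I : finType) (R_ : I -> pzRingType) : Type :=
  {dffun forall i : I, R_ i}.

Section DirectSum.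
Variables (I : finType) (R_ : I -> pzRingType).
Implicit Types x y z : dsum R_.

HB.instance Definition _ := Choice.on (dsum R_).

Definition dsum_of (f : forall i, R_ i) : dsum R_ := finfun f.
Definition dsum_zero : dsum R_ := dsum_of (fun=> 0).
Definition dsum_one : dsum R_ := dsum_of (fun=> 1).
Definition dsum_opp x : dsum R_ := dsum_of (fun i => - x i).
Definition dsum_add x y : dsum R_ := dsum_of (fun i => x i + y i).
Definition dsum_mul x y : dsum R_ := dsum_of (fun i => x i * y i).

Fact dsum_addA : associative dsum_add.
Proof. by move=> x y z; apply/ffunP=> i; rewrite !ffunE addrA. Qed.
Fact dsum_addC : commutative dsum_add.
Proof. by move=> x y; apply/ffunP=> i; rewrite !ffunE addrC. Qed.
Fact dsum_add0 : left_id dsum_zero dsum_add.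
Proof. by move=> x; apply/ffunP=> i; rewrite !ffunE add0r. Qed.
Fact dsum_addN : left_inverse dsum_zero dsum_opp dsum_add.
Proof. by move=> x; apply/ffunP=> i; rewrite !ffunE addNr. Qed.

HB.instance Definition _ := GRing.isZmodule.Build (dsum R_)
  dsum_addA dsum_addC dsum_add0 dsum_addN.

Fact dsum_mulA : associative dsum_mul.
Proof. by move=> x y z; apply/ffunP=> i; rewrite !ffunE mulrA. Qed.
Fact dsum_mul1l : left_id dsum_one dsum_mul.
Proof. by move=> x; apply/ffunP=> i; rewrite !ffunE mul1r. Qed.
Fact dsum_mul1r : right_id dsum_one dsum_mul.
Proof. by move=> x; apply/ffunP=> i; rewrite !ffunE mulr1. Qed.
Fact dsum_mulDl : left_distributive dsum_mul +%R.
Proof. by move=> x y z; apply/ffunP=> i; rewrite !ffunE mulrDl. Qed.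
Fact dsum_mulDr : right_distributive dsum_mul +%R.
Proof. by move=> x y z; apply/ffunP=> i; rewrite !ffunE mulrDr. Qed.

HB.instance Definition _ := GRing.Zmodule_isPzRing.Build (dsum R_)
  dsum_mulA dsum_mul1l dsum_mul1r dsum_mulDl dsum_mulDr.

End DirectSum.

Section NaturalBasis.
Variables (K : fieldType) (d : Order.disp_t) (E : finMeetSemilatticeType d).
Variables (k : nat) (X : k.-tuple {set E}) (G : 'I_k -> finGroupType).

(* Block i is a square matrix whose r-th row and column are indexed by the
   element [enum_val r] of X_i. *)
Definition blocks : Type :=
  dsum (fun i : 'I_k => 'M[galg K (G i)]_(#|tnth X i|)).

HB.instance Definition _ := GRing.PzRing.on blocks.

(* The matrix g_{a,b}, with g in position (a,b) of block i. *)
Definition unit_mx (i : 'I_k) (a b : E) (g : G i) : blocks :=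
  dsum_of (dfwith (fun j : 'I_k => 0 : 'M[galg K (G j)]_(#|tnth X j|))
    (\matrix_(r, c) if (enum_val r == a) && (enum_val c == b)
                    then galg_of K g else 0)).

(* The matrix ()_{a,a}.  The block containing a need not be given, since the
   other blocks have no row indexed by a. *)
Definition id_mx (a : E) : blocks :=
  dsum_of (fun i : 'I_k =>
    \matrix_(r, c) if (enum_val r == a) && (enum_val c == a)
                   then galg_of K (1%g : G i) else 0).

Definition nat_basis : {fset blocks} :=
  [fset unit_mx (tagged t).1.1 (tagged t).1.2 (tagged t).2
     | t in [pred t : {i : 'I_k & (E * E * G i)%type} |
              ((tagged t).1.1 \in tnth X (tag t)) &&
              ((tagged t).1.2 \in tnth X (tag t))]]%fset.

(* The linear extension to the algebra of (g_{a,b})^-1 = (g^-1)_{b,a}. *)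
Definition star (x : blocks) : blocks :=
  dsum_of (fun i : 'I_k =>
    \matrix_(r, c) ([ffun h : G i => x i c r (h^-1)%g] : galg K (G i))).

Definition bdom (x : blocks) : blocks := star x * x.
Definition bran (x : blocks) : blocks := x * star x.

Definition idempotent_basis : {fset blocks} := [fset id_mx a | a in E]%fset.

(* A binary relation on [nat_basis] is given by its graph. *)
Implicit Type R : {fset blocks * blocks}.

Definition partial_order R : Prop :=
  [/\ forall s t, (s, t) \in R -> s \in nat_basis /\ t \in nat_basis,
      forall s, s \in nat_basis -> (s, s) \in R,
      forall s t, (s, t) \in R -> (t, s) \in R -> s = t
    & forall s t u, (s, t) \in R -> (t, u) \in R -> (s, u) \in R].

Definition ESN_conditions R : Prop :=
  [/\ {in idempotent_basis &, forall e f,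
        exists g, [/\ g \in idempotent_basis, (g, e) \in R, (g, f) \in R
          & {in idempotent_basis, forall h,
              (h, e) \in R -> (h, f) \in R -> (h, g) \in R}]},
      {in nat_basis &, forall s t, (s, t) \in R -> (star s, star t) \in R},
      forall s t y z, s \in nat_basis -> t \in nat_basis ->
        y \in nat_basis -> z \in nat_basis ->
        (s, y) \in R -> (t, z) \in R -> s * t != 0 -> y * z != 0 ->
        (s * t, y * z) \in R,
      {in nat_basis &, forall e s, (e, bdom s) \in R ->
        exists! t, [/\ t \in nat_basis, (t, s) \in R & bdom t = e]}
    & {in nat_basis &, forall e s, (e, bran s) \in R ->
        exists! t, [/\ t \in nat_basis, (t, s) \in R & bran t = e]}].

Definition extends_order R : Prop :=
  forall a b : E, (id_mx a, id_mx b) \in R <-> (a <= b)%O.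

Definition bar R (b : blocks) : blocks :=
  \sum_(a <- nat_basis | (a, b) \in R) a.

Definition ESN R : named E :=
  @Named E
    (@FMagma blocks (fun x y => x * y) [fset bar R b | b in nat_basis]%fset)
    (fun e => bar R (id_mx e)).

End NaturalBasis.

(* The group f(X_i), when f gives positions in the list Gn.  The default value
   {perm void} is never used. *)
Definition group_at (Gn : seq finGroupType) (k : nat)
    (f : {ffun 'I_k -> 'I_(size Gn)}) (i : 'I_k) : finGroupType :=
  nth ({perm void} : finGroupType) Gn (f i).

(* The subroutines are arbitrary functions meeting their specifications; the
   sets that the algorithm loops over are lists in unspecified order.
   [Compositions n lam] is the set S_lam of admissible compositions. *)
Record subroutines (K : fieldType) (d : Order.disp_t) := Subroutines {
  Groups : nat -> seq finGroupType;
  GroupsP : forall n, representatives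
    (fun G H : finGroupType => [set: G] \isog [set: H])
    (fun G : finGroupType => (#|G| <= n)%N) (Groups n);

  Partitions : nat -> seq (seq nat);
  PartitionsP : forall m,
    enumerates (fun lam => is_partition m lam) (Partitions m);

  Compositions : nat -> seq nat -> seq (seq nat);
  CompositionsP : forall n m lam, (0 < m)%N -> is_partition m lam ->
    enumerates (fun C => admissible n lam C) (Compositions n lam);

  MeetSemilattices : nat -> seq (finMeetSemilatticeType d);
  MeetSemilatticesP : forall m, (0 < m)%N ->
    representatives (@semilattice_iso d)
      (fun E : finMeetSemilatticeType d => #|E| = m) (MeetSemilattices m);

  DPartitions : forall (E : finMeetSemilatticeType d) (lam : seq nat),
    seq ((size lam).-tuple {set E});
  DPartitions_ordered : forall (E : finMeetSemilatticeType d) (lam : seq nat)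
      (X : (size lam).-tuple {set E}), X \in DPartitions E lam ->
    uniq X /\ sorted geq [seq #|Y| | Y : {set E} <- X];
  DPartitionsP : forall (E : finMeetSemilatticeType d) (lam : seq nat),
    enumerates (fun P : {set {set E}} => D_partition P /\ shape_of P = lam)
      [seq [set Y in tval X] | X <- DPartitions E lam];

  GroupMaps : forall (E : finMeetSemilatticeType d) (k : nat)
      (X : k.-tuple {set E}) (C : seq nat) (Gn : seq finGroupType),
    seq {ffun 'I_k -> 'I_(size Gn)};
  GroupMapsP : forall (E : finMeetSemilatticeType d) (k : nat)
      (X : k.-tuple {set E}) (C : seq nat) (Gn : seq finGroupType),
    size C = k ->
    enumerates (fun f => forall i : 'I_k, #|group_at f i| = nth 0%N C i)
      (GroupMaps X C Gn);

  GPosets : forall (E : finMeetSemilatticeType d) (k : nat)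
      (X : k.-tuple {set E}) (G : 'I_k -> finGroupType),
    seq {fset blocks K X G * blocks K X G};
  GPosetsP : forall (E : finMeetSemilatticeType d) (k : nat)
      (X : k.-tuple {set E}) (G : 'I_k -> finGroupType),
    uniq X -> D_partition [set Y in tval X] ->
    enumerates (fun R => [/\ partial_order R, ESN_conditions R
                           & extends_order R]) (GPosets X G);

  inv_type : eqType;
  Invariants : forall E : finMeetSemilatticeType d, named E -> inv_type;
  InvariantsP : forall (E : finMeetSemilatticeType d) (S T : named E),
    inverse_semigroup S -> inverse_semigroup T ->
    idempotents_are S -> idempotents_are T ->
    isomorphic S T -> Invariants S = Invariants T
}.

Section Dictionary.
Variables (Key : eqType) (V : Type).

Definition dict := seq (Key * seq V).

Fixpoint lookup (I : Key) (D : dict) : option (seq V) :=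
  if D is (J, l) :: D' then if J == I then Some l else lookup I D' else None.

Fixpoint append_at (I : Key) (x : V) (D : dict) : dict :=
  if D is (J, l) :: D' then
    if J == I then (J, rcons l x) :: D' else (J, l) :: append_at I x D'
  else [:: (I, [:: x])].

Definition contents (D : dict) : seq V := flatten [seq p.2 | p <- D].

End Dictionary.

Section Algorithm.
Variables (K : fieldType) (d : Order.disp_t) (sub : subroutines K d).
Local Notation Inv := (Invariants sub).

Definition IsNew (E : finMeetSemilatticeType d) (S : named E)
    (I : inv_type sub) (isgs : dict (inv_type sub) (named E)) : bool :=
  if lookup I isgs is Some l then ~~ has (fun T : named E => `[< isomorphic S T >]) l
  else true.

Definition insert (E : finMeetSemilatticeType d)
    (isgs : dict (inv_type sub) (named E)) (S : named E) :=
  let I := Inv S in if IsNew S I isgs then append_at I S isgs else isgs.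

Definition isgs_of (n : nat) (E : finMeetSemilatticeType d) (lam : seq nat) :
    dict (inv_type sub) (named E) :=
  let Gn := Groups sub n in
  foldl (fun D C =>
    foldl (fun D X =>
      foldl (fun D f =>
        foldl (fun D R => insert D (ESN R))
          D (GPosets sub X (group_at f)))
        D (GroupMaps sub X C Gn))
      D (DPartitions sub E lam))
    [::] (Compositions sub n lam).

Definition enumeration (n : nat) : seq fmagma :=
  flatten [seq
    flatten [seq
      flatten [seq map (@magma_of E) (contents (isgs_of n E lam))
        | lam <- Partitions sub m]
      | E : finMeetSemilatticeType d <- MeetSemilattices sub m]
    | m <- iota 1 n].

End Algorithm.

(* Main.v *)
Require Import Defs.
From HB Require Import structures.
From Stdlib Require List.
From mathcomp Require Import all_boot all_order all_fingroup all_algebra.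
From mathcomp Require Import finmap complex boolp reals.

(** The algorithm runs the Ehresmann-Schein-Nambooripad correspondence between
    inverse semigroups and ordered groupoids whose identities form a
    semilattice.

    Soundness. The natural basis [B] of a sum of matrix algebras over group
    algebras is a groupoid, in which a product that is not defined is zero. Let
    [bar s] be the sum of the elements of [B] below [s]. If [e] is the meet of
    the domain of [s] and the range of [t], then [bar s * bar t = bar (s' * t')],
    where [s'] and [t'] are the restrictions of [s] and [t] to [e]
    ([down_mul]). So the set of all [bar s] is closed under multiplication, and
    it is associative because the algebra is. Its idempotents are the [bar e] for
    identities [e], which multiply as meets and hence commute; together with the
    inverses [bar (star s)] this gives an inverse semigroup
    ([down_inverse_semigroup]). Linear independence makes [bar] injective, so
    the order of the semigroup is the number of basis matrices
    ([card_nat_basis]), which admissibility makes equal to [n]. The semilattice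
    of idempotents is [E], and the D-classes of idempotents are the blocks of
    the given partition ([candidates_valid]).

    No repetition. An isomorphism induces an isomorphism between the
    semilattices of idempotents and preserves the relation D
    ([isomorphic_invariants]). Hence isomorphic outputs come from the same [E]
    and the same shape [lam], that is, from the same dictionary, where the test
    made before each insertion excludes them ([foldl_insert_spec]).

    Completeness. Let [S] be an inverse semigroup of order [n]. Its D-classes
    partition the semilattice of idempotents, and conjugation shows that this is
    a D-partition ([D_blocks_D_partition]). Choosing a base idempotent in each
    class and an element from it to every other idempotent of the class turns
    the elements of [S] into the basis matrices over the maximal subgroups
    ([coord]): products [x y] with [x^-1 x = y y^-1] become matrix products. The
    natural partial order of [S], carried over to the matrices, satisfies the
    ESN conditions ([transported_esn_order]). Since [x y = (x e) (e y)] with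
    [e = x^-1 x y y^-1], the product formula above says that [x] going to
    [bar (coord x)] is multiplicative, so [S] is isomorphic to the semigroup
    constructed from this order ([realization]), which the loops of the
    algorithm reach ([completeness]). *)

Set Implicit Arguments.
Unset Strict Implicit.
Unset Printing Implicit Defensive.

Import Order.TTheory GRing.Theory.

(** * Lists and dictionaries *)

Lemma In_cat (T : Type) (x : T) s t : List.In x (s ++ t) <-> List.In x s \/ List.In x t.
Proof. exact: List.in_app_iff. Qed.

Lemma In_map (T U : Type) (f : T -> U) s y :
  List.In y (map f s) <-> exists2 x, List.In x s & f x = y.
Proof.
elim: s y => [|x s IHs] y /=; first by split=> // -[].
split=> [[<-|/IHs[z sz <-]]|[z [->|sz] <-]]; first by exists x => //; left.
- by exists z => //; right.
- by left.
by right; apply/IHs; exists z.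
Qed.

Lemma In_flatten (T : Type) (ss : seq (seq T)) x :
  List.In x (flatten ss) <-> exists2 s, List.In s ss & List.In x s.
Proof.
elim: ss => [|s ss IHss] /=; first by split=> // -[].
rewrite In_cat IHss; split=> [[sx|[t sst tx]]|[t [->|sst] tx]].
- by exists s => //; left.
- by exists t => //; right.
- by left.
by right; exists t.
Qed.

Lemma In_flatten_map (T U : Type) (F : U -> seq T) l x :
  List.In x (flatten (map F l)) <-> exists2 y, List.In y l & List.In x (F y).
Proof.
rewrite In_flatten; split=> [[s /In_map[y ly <-] sx]|[y ly Fyx]]; first by exists y.
by exists (F y) => //; apply/In_map; exists y.
Qed.

Lemma ForallOrdPairs_cat (T : Type) (R : T -> T -> Prop) s t :
  List.ForallOrdPairs R s -> List.ForallOrdPairs R t ->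
  (forall x y, List.In x s -> List.In y t -> R x y) ->
  List.ForallOrdPairs R (s ++ t).
Proof.
elim: s => [|x s IHs] //= Hs Ht Hst; inversion_clear Hs as [|? ? Hx Hs'].
constructor; last by apply: IHs => // y z sy tz; apply: Hst => //; right.
apply/List.Forall_forall => y /In_cat[sy|ty]; last by apply: Hst => //; left.
by move/List.Forall_forall: Hx; apply.
Qed.

(** Two entries of the flattened list come either from the same inner list or
    from inner lists with different indices, which [Q] then separates. *)
Lemma ForallOrdPairs_flatten (T U : Type) (Q : U -> U -> Prop) (R : T -> T -> Prop)
    (F : U -> seq T) l :
  List.ForallOrdPairs Q l ->
  (forall x, List.In x l -> List.ForallOrdPairs R (F x)) ->
  (forall x y, List.In x l -> List.In y l -> Q x y ->
     forall a b, List.In a (F x) -> List.In b (F y) -> R a b) ->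
  List.ForallOrdPairs R (flatten (map F l)).
Proof.
elim: l => [|x l IHl] /= Hl HF HQ; first by constructor.
inversion_clear Hl as [|? ? Hx Hl'].
apply: ForallOrdPairs_cat.
- by apply: HF; left.
- apply: IHl => // [y ly|y z ly lz]; first by apply: HF; right.
  by apply: HQ; right.
move=> a b Fa /In_flatten_map[y ly Fb].
have {}Hx: Q x y by move/List.Forall_forall: Hx; apply.
by apply: (HQ x y _ _ Hx) => //; [left|right].
Qed.

Lemma ForallOrdPairs_map (T U : Type) (f : U -> T) (R : T -> T -> Prop) l :
  List.ForallOrdPairs (fun x y => R (f x) (f y)) l ->
  List.ForallOrdPairs R (map f l).
Proof.
elim: l => [|x l IHl] /= Hl; first by constructor.
inversion_clear Hl as [|? ? Hx Hl']; constructor; last exact: IHl.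
by apply/List.Forall_forall => _ /In_map[y ly <-]; move/List.Forall_forall: Hx; apply.
Qed.

Lemma eq_foldl (T V : Type) (f g : V -> T -> V) z s :
  (forall z x, f z x = g z x) -> foldl f z s = foldl g z s.
Proof. by move=> fg; elim: s z => //= x s IHs z; rewrite fg. Qed.

Lemma foldl_flatten (T U V : Type) (g : V -> T -> V) (F : U -> seq T) z l :
  foldl (fun D x => foldl g D (F x)) z l = foldl g z (flatten (map F l)).
Proof. by elim: l z => //= x l IHl z; rewrite IHl foldl_cat. Qed.

Lemma foldl_map (T U V : Type) (g : V -> T -> V) (f : U -> T) z l :
  foldl (fun D x => g D (f x)) z l = foldl g z (map f l).
Proof. by elim: l z => //= x l IHl z. Qed.

Lemma In_mem (T : eqType) (x : T) s : List.In x s <-> x \in s.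
Proof.
elim: s => [|y s IHs] //=; rewrite inE; split.
  by case=> [->|/IHs ->]; rewrite ?eqxx ?orbT.
by case/predU1P=> [->|/IHs]; [left|right].
Qed.

Lemma uniq_ForallOrdPairs (T : eqType) (s : seq T) :
  uniq s -> List.ForallOrdPairs (fun x y => x <> y) s.
Proof.
elim: s => [|x s IHs] /=; first by constructor.
case/andP=> xs /IHs Hs; constructor=> //; apply/List.Forall_forall => y /In_mem sy.
by move=> xy; rewrite xy sy in xs.
Qed.

Lemma In_has (T : Type) (a : pred T) s : has a s <-> exists2 x, List.In x s & a x.
Proof.
elim: s => [|x s IHs] /=; first by split=> // -[].
split=> [/orP[ax|/IHs[y sy ay]]|[y [->|sy] ay]].
- by exists x => //; left.
- by exists y => //; right.
- by rewrite ay.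
by apply/orP; right; apply/IHs; exists y.
Qed.

Lemma In_nth (T : Type) (x0 x : T) s :
  List.In x s -> exists i : 'I_(size s), nth x0 s i = x.
Proof.
elim: s => //= y s IHs [->|/IHs[i <-]]; first by exists ord0.
by exists (lift ord0 i).
Qed.

Section DictionaryTheory.
Variables (Key : eqType) (V : Type).
Implicit Types D : dict Key V.

Lemma In_contents D S :
  List.In S (contents D) <-> exists2 p, List.In p D & List.In S p.2.
Proof. exact: In_flatten_map. Qed.

Lemma lookup_In I D l : lookup I D = Some l -> List.In (I, l) D.
Proof.
elim: D => //= -[J k] D IHD; case: eqP => [->[->]|_ /IHD]; by [left|right].
Qed.

Lemma In_append I x D S :
  List.In S (contents (append_at I x D)) <-> S = x \/ List.In S (contents D).
Proof.
elim: D => [|[J l] D IHD] /=; first by split=> -[->|]; auto.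
rewrite /contents in IHD *; case: eqP => _ /=.
  by rewrite !In_cat -cats1 In_cat /=; intuition.
by rewrite !In_cat IHD; intuition.
Qed.

Lemma append_keys I x D :
  map fst (append_at I x D) =
  if I \in map fst D then map fst D else rcons (map fst D) I.
Proof.
elim: D => //= -[J l] D IHD; rewrite inE eq_sym.
by case: eqP => //= _; rewrite IHD; case: ifP.
Qed.

Variables (key : V -> Key) (sim : V -> V -> Prop).

Definition well_keyed D : Prop :=
  uniq (map fst D) /\
  forall p, List.In p D -> forall S, List.In S p.2 -> key S = p.1.

Lemma append_well_keyed x D : well_keyed D -> well_keyed (append_at (key x) x D).
Proof.
case=> uD kD; split.
  rewrite append_keys; case: ifP => // /negbT; rewrite rcons_uniq => ->.
  by [].
elim: D {uD} kD => [|[J l] D IHD] /= kD p; first by case=> // <- S /= [<-|].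
case: eqP => [JI|_] /= [<-|Dp].
- move=> S /=; rewrite -cats1 => /In_cat[lS|/= [<-|//]] //.
  by apply: (kD (J, l)) => //; left.
- by apply: kD; right.
- by apply: kD; left.
by apply: IHD => // q Dq; apply: kD; right.
Qed.

Lemma well_keyed_behead p D : well_keyed (p :: D) -> well_keyed D.
Proof. by case=> /= /andP[_ uD] kD; split=> // q Dq; apply: kD; right. Qed.

(** Comparing a new value with the entries stored under its own key is enough,
    because similar values have equal keys. *)
Lemma append_pairwise x D :
  well_keyed D ->
  (forall S, List.In S (contents D) -> sim S x -> key S = key x) ->
  (forall l S, lookup (key x) D = Some l -> List.In S l -> ~ sim S x) ->
  (forall S, List.In S (contents D) -> sim x S -> sim S x) ->
  List.ForallOrdPairs (fun S T => ~ sim S T) (contents D) ->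
  List.ForallOrdPairs (fun S T => ~ sim S T) (contents (append_at (key x) x D)).
Proof.
elim: D => [|[J l] D IHD] /= wD same new sym; rewrite /contents /=.
  by move=> _; do 2 constructor.
have kl S : List.In S l -> key S = J.
  by move=> lS; case: wD => _ /(_ (J, l)); apply=> //; left.
have In_l S : List.In S l -> List.In S (contents ((J, l) :: D)).
  by move=> lS; apply/In_cat; left.
have In_D S : List.In S (contents D) -> List.In S (contents ((J, l) :: D)).
  by move=> DS; apply/In_cat; right.
move=> HD; have [Hl [HD' HlD]]: List.ForallOrdPairs (fun S T => ~ sim S T) l /\
    List.ForallOrdPairs (fun S T => ~ sim S T) (contents D) /\
    (forall S T, List.In S l -> List.In T (contents D) -> ~ sim S T).
  rewrite -/(contents D) in HD.
  elim: (l) HD => [|y m IHm] /= Hm; first by split; [constructor|].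
  inversion_clear Hm as [|? ? Hy Hm']; have [H1 [H2 H3]] := IHm Hm'.
  move/List.Forall_forall: Hy => Hy; split; last split=> //.
    by constructor=> //; apply/List.Forall_forall => z mz; apply/Hy/In_cat; left.
  by move=> S T [<-|mS] DT; [apply/Hy/In_cat; right|apply: H3].
case: eqP => [JI|JI] /=; rewrite -/(contents _).
  apply: ForallOrdPairs_cat => //.
    rewrite -cats1; apply: ForallOrdPairs_cat => //; first by do 2 constructor.
    move=> S T lS /= [<-|//]; apply: (new l) => //.
    by rewrite JI eqxx.
  move=> S T; rewrite -cats1 => /In_cat[lS|/= [<-|//]] DT; first exact: HlD.
  move/(sym T (In_D T DT)) => Tx; have kT := same T (In_D T DT) Tx.
  case/In_contents: DT => p Dp pT; case: wD => /= /andP[/negP nJ _] /(_ p) kp.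
  apply: nJ; rewrite JI -kT (kp (or_intror Dp) _ pT).
  by apply/In_mem/In_map; exists p.
apply: ForallOrdPairs_cat => //.
  apply: IHD => // [|S DS|m S|S DS].
  - exact: well_keyed_behead wD.
  - exact/same/In_D.
  - by move=> Dm; apply: new; case: eqP JI.
  exact/sym/In_D.
move=> S T lS /In_append[->|DT]; last exact: HlD.
by move/(same S (In_l S lS)); rewrite kl.
Qed.

End DictionaryTheory.

(** * Inverse semigroups as finite magmas *)

Section Magmas.
Local Open Scope fset_scope.

Definition mutually_inverse (S : fmagma) (x y : ambient S) : Prop :=
  op (op x y) x = x /\ op (op y x) y = y.

(** If [y] and [z] are inverse to [x], then [x y], [x z] are idempotents and so
    are [y x], [z x]; moving them past each other gives [y = y x z = z]. *)
Lemma regular_commuting_inverse (S : fmagma) :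
  elts S != fset0 ->
  {in elts S &, forall x y, op x y \in elts S} ->
  {in elts S & &, forall x y z, op x (op y z) = op (op x y) z} ->
  {in elts S, forall x, exists2 y, y \in elts S & mutually_inverse x y} ->
  {in elts S &, forall e f, op e e = e -> op f f = f -> op e f = op f e} ->
  inverse_semigroup S.
Proof.
move=> S0 cl asc reg com; split=> // x Sx.
have [y Sy [xyx yxy]] := reg x Sx; exists y; split=> // z [Sz xzx zxz].
have mid u v : u \in elts S -> v \in elts S -> op (op x u) x = x ->
    op (op u x) u = u -> op (op x v) x = x -> op (op v x) v = v ->
    u = op (op u x) v.
  move=> Su Sv xux uxu xvx vxv.
  have Sxu := cl _ _ Sx Su; have Sxv := cl _ _ Sx Sv.
  have ixu : op (op x u) (op x u) = op x u by rewrite asc // xux.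
  have ixv : op (op x v) (op x v) = op x v by rewrite asc // xvx.
  (* u = u x u = u (x v) (x u) = u (x u) (x v) = u x v *)
  rewrite -{1}uxu -{1}xvx -(asc u) ?cl // -(asc (op x v)) // (com _ _ Sxv Sxu) //.
  by rewrite [op (op x u) _]asc // xux -asc.
have mid' u v : u \in elts S -> v \in elts S -> op (op x u) x = x ->
    op (op u x) u = u -> op (op x v) x = x -> op (op v x) v = v ->
    v = op (op u x) v.
  move=> Su Sv xux uxu xvx vxv.
  have Sux := cl _ _ Su Sx; have Svx := cl _ _ Sv Sx.
  have iux : op (op u x) (op u x) = op u x by rewrite asc // uxu.
  have ivx : op (op v x) (op v x) = op v x by rewrite asc // vxv.
  (* v = v x v = (v x) (u x) v = (u x) (v x) v = u x v *)
  have vx : op (op v x) (op u x) = op v x by rewrite -(asc v) // (asc x) // xux.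
  have vxuxv : op (op u x) (op (op v x) v) = v.
    by rewrite asc // (com _ _ Sux Svx) // vx vxv.
  by rewrite vxv in vxuxv.
by rewrite (mid y z) // -(mid' y z).
Qed.

Lemma mutually_inverse_unique (S : fmagma) x y z :
  inverse_semigroup S -> x \in elts S -> y \in elts S -> z \in elts S ->
  mutually_inverse x y -> mutually_inverse x z -> y = z.
Proof.
case=> _ _ _ uniq_inv Sx Sy Sz [h1 h2] [h3 h4].
by have [w [_ uw]] := uniq_inv x Sx; rewrite -(uw y) // -(uw z).
Qed.

(** For idempotents [e] and [f] this is Green's relation D. *)
Definition D_related (S : fmagma) (e f : ambient S) : Prop :=
  exists x y, [/\ x \in elts S /\ y \in elts S, mutually_inverse x y,
    op x y = e & op y x = f].

End Magmas.

Section Isomorphisms.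
Local Open Scope fset_scope.
Implicit Types S T U : fmagma.

Lemma isomorphic_refl S : isomorphic S S.
Proof.
exists id; split=> //; apply/fsetP=> x.
by apply/imfsetP/idP => [[y Sy ->]|Sx] //; exists x.
Qed.

Lemma isomorphic_sym S T : inverse_semigroup S -> isomorphic S T -> isomorphic T S.
Proof.
case=> /fset0Pn[x0 Sx0] cl _ _ [phi [inj im mor]].
have [psi psiP] : {psi & forall y, y \in elts T -> psi y \in elts S /\ phi (psi y) = y}.
  apply: (@choice _ _ (fun y x => y \in elts T -> x \in elts S /\ phi x = y)) => y.
  case: (boolP (y \in elts T)) => [|_]; last by exists x0.
  by rewrite -im => /imfsetP[x Sx ->]; exists x.
have psiK x : x \in elts S -> psi (phi x) = x.
  move=> Sx; have [|Sy py] := psiP (phi x); last exact: inj.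
  by rewrite -im; apply/imfsetP; exists x.
exists psi; split.
- by move=> x y /psiP[_ {2}<-] /psiP[_ {2}<-] ->.
- apply/fsetP=> x; apply/imfsetP/idP => [[y /psiP[Sy _] ->] //|Sx].
  by exists (phi x); rewrite ?psiK //= -im; apply/imfsetP; exists x.
move=> x y /psiP[Sx {1}<-] /psiP[Sy {1}<-].
by rewrite -mor // psiK // cl.
Qed.

Lemma isomorphic_trans S T U : isomorphic S T -> isomorphic T U -> isomorphic S U.
Proof.
case=> phi [inj im mor] [psi [inj' im' mor']].
have Tphi x : x \in elts S -> phi x \in elts T.
  by move=> Sx; rewrite -im; apply/imfsetP; exists x.
exists (psi \o phi); split.
- by move=> x y Sx Sy /= /inj'-/(_ (Tphi _ Sx) (Tphi _ Sy))/inj; apply.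
- apply/fsetP=> z; rewrite -im' -im; apply/imfsetP/imfsetP => [[x Sx ->]|[_ /imfsetP[x Sx ->] ->]].
    by exists (phi x) => //; apply/imfsetP; exists x.
  by exists x.
by move=> x y Sx Sy /=; rewrite mor // mor' ?Tphi.
Qed.

End Isomorphisms.

(** * The Ehresmann-Schein-Nambooripad construction in a ring *)

Section GroupoidBasis.
Local Open Scope fset_scope.
Local Open Scope ring_scope.
Variables (A : pzRingType) (B F : {fset A}) (star : A -> A).

(** The properties of the natural basis on which the construction rests: the
    nonzero products make [B] a groupoid, with inverse [star] and set of
    identities [F], and distinct subsets of [B] have distinct sums. The last
    property is the part of linear independence that makes [bar] injective. *)
Record groupoid_basis : Prop := GroupoidBasis {
  gb_star : {in B, forall x, star x \in B};
  gb_starK : {in B, cancel star star};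
  gb_starM : {in B &, forall x y, star (x * y) = star y * star x};
  gb_mul : {in B &, forall x y, star x * x = y * star y -> x * y \in B};
  gb_mul0 : {in B &, forall x y, star x * x != y * star y -> x * y = 0};
  gb_regular : {in B, forall x, x * star x * x = x};
  gb_dom : {in B, forall x, star x * x \in F};
  gb_sub : {in F, forall e, e \in B};
  gb_star_id : {in F, forall e, star e = e};
  gb_idem : {in F, forall e, e * e = e};
  gb_indep : forall P Q : pred A,
    \sum_(a <- B | P a) a = \sum_(a <- B | Q a) a -> {in B, P =1 Q}
}.

(** The predicates [partial_order] and [ESN_conditions], for the basis of an
    arbitrary ring. *)
Record esn_order (R : {fset A * A}) : Prop := EsnOrder {
  eo_sub : forall s t, (s, t) \in R -> s \in B /\ t \in B;
  eo_refl : forall s, s \in B -> (s, s) \in R;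
  eo_anti : forall s t, (s, t) \in R -> (t, s) \in R -> s = t;
  eo_trans : forall s t u, (s, t) \in R -> (t, u) \in R -> (s, u) \in R;
  eo_meet : {in F &, forall e f,
        exists g, [/\ g \in F, (g, e) \in R, (g, f) \in R
          & {in F, forall h,
              (h, e) \in R -> (h, f) \in R -> (h, g) \in R}]};
  eo_star : {in B &, forall s t, (s, t) \in R -> (star s, star t) \in R};
  eo_mul : forall s t y z, s \in B -> t \in B -> y \in B -> z \in B ->
        (s, y) \in R -> (t, z) \in R -> s * t != 0 -> y * z != 0 ->
        (s * t, y * z) \in R;
  eo_restr : {in B &, forall e s, (e, star s * s) \in R ->
        exists! t, [/\ t \in B, (t, s) \in R & star t * t = e]};
  eo_corestr : {in B &, forall e s, (e, s * star s) \in R ->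
        exists! t, [/\ t \in B, (t, s) \in R & t * star t = e]}
}.

(** The sums [bar] and the semigroup [ESN], over an arbitrary ring with a
    groupoid basis; for the natural basis the two are convertible. *)
Definition down (R : {fset A * A}) (b : A) : A := \sum_(a <- B | (a, b) \in R) a.

Definition down_magma (R : {fset A * A}) : fmagma :=
  @FMagma A (fun x y => x * y) [fset down R b | b in B].

Hypothesis gb : groupoid_basis.
Implicit Types s t u x y e f g h : A.

Local Notation dom x := (star x * x).
Local Notation ran x := (x * star x).

Lemma gb_ran x : x \in B -> ran x \in F.
Proof.
by move=> Bx; rewrite -{1}(gb_starK gb Bx); apply: (gb_dom gb); apply: (gb_star gb).
Qed.

Lemma zero_notin_basis : 0 \notin B.
Proof.
apply/negP=> B0; have := @gb_indep gb (pred1 0) pred0.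
rewrite big_pred0_eq big1 => [/(_ erefl _ B0)|a /eqP //].
by rewrite /= eqxx.
Qed.

Lemma mul_neq0 x y : x \in B -> y \in B -> (x * y != 0) = (dom x == ran y).
Proof.
move=> Bx By; case: (dom x =P ran y) => [xy|/eqP xy]; last by rewrite (gb_mul0 gb) // eqxx.
apply/eqP=> xy0; have := gb_mul gb Bx By xy.
by rewrite xy0 (negPf zero_notin_basis).
Qed.

Lemma star_regular x : x \in B -> dom x * star x = star x.
Proof.
by move=> Bx; rewrite -{2}(gb_starK gb Bx) (gb_regular gb) // (gb_star gb).
Qed.

Lemma dom_mul x y : x \in B -> y \in B -> dom x = ran y -> dom (x * y) = dom y.
Proof.
move=> Bx By xy; rewrite (gb_starM gb) // mulrA -(mulrA (star y)) xy.
by rewrite -mulrA (gb_regular gb).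
Qed.

Lemma ran_mul x y : x \in B -> y \in B -> dom x = ran y -> ran (x * y) = ran x.
Proof.
move=> Bx By xy; rewrite (gb_starM gb) // -mulrA (mulrA y) -xy.
by rewrite star_regular.
Qed.

Lemma dom_id e : e \in F -> dom e = e.
Proof. by move=> Fe; rewrite (gb_star_id gb) // (gb_idem gb). Qed.

Lemma ran_id e : e \in F -> ran e = e.
Proof. by move=> Fe; rewrite (gb_star_id gb) // (gb_idem gb). Qed.

Variable R : {fset A * A}.
Hypothesis eo : esn_order R.

Local Notation "x <~ y" := ((x, y) \in R) (at level 70).
Local Notation bar := (down R).

Lemma below_basis s t : s <~ t -> s \in B.
Proof. by case/(eo_sub eo). Qed.

Lemma dom_mono s t : s <~ t -> dom s <~ dom t.
Proof.
move=> st; have [Bs Bt] := eo_sub eo st; have Fs := gb_dom gb Bs.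
have neq0 x : x \in B -> dom x != 0.
  move=> Bx; apply: contraTneq (gb_sub gb (gb_dom gb Bx)) => ->.
  exact: zero_notin_basis.
by apply: (eo_mul eo); rewrite ?(gb_star gb) ?neq0 //; apply: (eo_star eo).
Qed.

Lemma ran_mono s t : s <~ t -> ran s <~ ran t.
Proof.
move=> st; have [Bs Bt] := eo_sub eo st.
by rewrite -{1}(gb_starK gb Bs) -{1}(gb_starK gb Bt); apply/dom_mono/(eo_star eo).
Qed.

Lemma dom_below_inj s t u : s <~ u -> t <~ u -> dom s = dom t -> s = t.
Proof.
move=> su tu st; have [Bs Bu] := eo_sub eo su; have [Bt _] := eo_sub eo tu.
have [v [_ uniqv]] := eo_restr eo (gb_sub gb (gb_dom gb Bs)) Bu (dom_mono su).
by rewrite -(uniqv s) // -(uniqv t).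
Qed.

Lemma ran_below_inj s t u : s <~ u -> t <~ u -> ran s = ran t -> s = t.
Proof.
move=> su tu st; have [Bs Bu] := eo_sub eo su; have [Bt _] := eo_sub eo tu.
have [v [_ uniqv]] := eo_corestr eo (gb_sub gb (gb_ran Bs)) Bu (ran_mono su).
by rewrite -(uniqv s) // -(uniqv t).
Qed.

Lemma below_id e f : f \in F -> e <~ f -> e \in F.
Proof.
move=> Ff ef; have [t [[Bt _ <-] _]] : exists! t, [/\ t \in B, t <~ f & dom t = e].
  apply: (eo_restr eo); rewrite ?dom_id //; first exact: below_basis ef.
  exact: (gb_sub gb).
exact: (gb_dom gb).
Qed.

(** The restriction (s|f) and the corestriction (f|t) of an ordered groupoid.
    They exist only for [f] below the domain of [s] or the range of [t]; the
    default value [0] stands for the other cases. *)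
Definition restr s f : A :=
  let P t := (t <~ s) && (dom t == f) in nth 0 B (find P B).
Definition corestr f t : A :=
  let P s := (s <~ t) && (ran s == f) in nth 0 B (find P B).

Lemma restrP s f : s \in B -> f <~ dom s ->
  [/\ restr s f \in B, restr s f <~ s & dom (restr s f) = f].
Proof.
move=> Bs fs; rewrite /restr /=; set P := fun t : A => _.
have hP : has P B.
  have [t [[Bt ts tf] _]] := eo_restr eo (below_basis fs) Bs fs.
  by apply/hasP; exists t => //; rewrite /P ts tf eqxx.
have /andP[Ps /eqP Pf] := nth_find 0 hP.
by split=> //; apply: mem_nth; rewrite -has_find.
Qed.

Lemma corestrP f t : t \in B -> f <~ ran t ->
  [/\ corestr f t \in B, corestr f t <~ t & ran (corestr f t) = f].
Proof.
move=> Bt ft; rewrite /corestr /=; set P := fun s : A => _.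
have hP : has P B.
  have [s [[Bs st sf] _]] := eo_corestr eo (below_basis ft) Bt ft.
  by apply/hasP; exists s => //; rewrite /P st sf eqxx.
have /andP[Ps /eqP Pf] := nth_find 0 hP.
by split=> //; apply: mem_nth; rewrite -has_find.
Qed.

(** Restriction and corestriction both enumerate the elements below a given one
    by the idempotents below its domain or range, and so do their products; all
    three enumerations have this form. *)
Lemma down_reindex u e (H : A -> A) :
  (forall f, f <~ e -> H f <~ u) ->
  (forall f g, f <~ e -> g <~ e -> H f = H g -> f = g) ->
  (forall c, c <~ u -> exists2 f, f <~ e & H f = c) ->
  bar u = \sum_(f <- B | f <~ e) H f.
Proof.
move=> Hu Hinj Hsurj; rewrite /down -big_filter -[RHS]big_filter.
rewrite -[RHS](big_map H xpredT id); apply: perm_big.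
apply: uniq_perm; first by rewrite filter_uniq ?fset_uniq.
  rewrite map_inj_in_uniq ?filter_uniq ?fset_uniq // => f g.
  by rewrite !mem_filter => /andP[fe _] /andP[ge _]; apply: Hinj.
move=> c; rewrite mem_filter; apply/andP/mapP=> [[cu _]|[f]].
  have [f fe <-] := Hsurj _ cu; exists f => //.
  by rewrite mem_filter fe; have := below_basis fe.
by rewrite mem_filter => /andP[fe _] ->; split; [|apply: (@below_basis _ u)]; apply: Hu.
Qed.

Lemma down_restr s : s \in B -> bar s = \sum_(f <- B | f <~ dom s) restr s f.
Proof.
move=> Bs; apply: down_reindex => [f fs|f g fs gs fg|c cs].
- by have [] := restrP Bs fs.
- by have [_ _ <-] := restrP Bs fs; rewrite fg; have [] := restrP Bs gs.
have [Br rs rc] := restrP Bs (dom_mono cs).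
by exists (dom c); [apply: dom_mono|apply: (dom_below_inj rs cs rc)].
Qed.

Lemma down_corestr t : t \in B -> bar t = \sum_(f <- B | f <~ ran t) corestr f t.
Proof.
move=> Bt; apply: down_reindex => [f ft|f g ft gt fg|c ct].
- by have [] := corestrP Bt ft.
- by have [_ _ <-] := corestrP Bt ft; rewrite fg; have [] := corestrP Bt gt.
have [Br rt rc] := corestrP Bt (ran_mono ct).
by exists (ran c); [apply: ran_mono|apply: (ran_below_inj rt ct rc)].
Qed.

Definition is_meet e f g : Prop :=
  [/\ e <~ f, e <~ g & {in F, forall h, h <~ f -> h <~ g -> h <~ e}].

(** The pseudoproduct of an ordered groupoid is multiplication in the algebra.
    Expanding both sums over restrictions (s|f) and corestrictions (g|t), only
    the pairs with [f = g] have a nonzero product; then [f] is below the meet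
    [e], and (s|f)(f|t) runs once through the elements below [s' * t']. *)
Lemma down_mul s t s' t' e : s \in B -> t \in B -> s' <~ s -> t' <~ t ->
  dom s' = e -> ran t' = e -> is_meet e (dom s) (ran t) ->
  bar s * bar t = bar (s' * t').
Proof.
move=> Bs Bt ss tt ds rt [es et emax].
have [Bs' Bt'] := (below_basis ss, below_basis tt).
have st' : dom s' = ran t' by rewrite ds.
have Bst := gb_mul gb Bs' Bt' st'.
have ltF f : f <~ dom s -> f \in F by apply: below_id; apply: (gb_dom gb).
have below f : f <~ e -> [/\ f <~ dom s, f <~ ran t & f \in F].
  by move=> fe; have fs := eo_trans eo fe es; split; rewrite ?(eo_trans eo fe et) ?ltF.
have restrE f : f <~ e -> restr s f <~ s'.
  move=> fe; have [fs ft Ff] := below f fe.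
  have fs' : f <~ dom s' by rewrite ds.
  have [B1 r1 d1] := restrP Bs fs; have [B2 r2 d2] := restrP Bs' fs'.
  by rewrite (dom_below_inj r1 (eo_trans eo r2 ss)) ?d1 ?d2.
have corestrE f : f <~ e -> corestr f t <~ t'.
  move=> fe; have [fs ft Ff] := below f fe.
  have ft' : f <~ ran t' by rewrite rt.
  have [B1 r1 d1] := corestrP Bt ft; have [B2 r2 d2] := corestrP Bt' ft'.
  by rewrite (ran_below_inj r1 (eo_trans eo r2 tt)) ?d1 ?d2.
have matched f : f <~ e -> [/\ restr s f \in B, corestr f t \in B,
    dom (restr s f) = ran (corestr f t) & dom (restr s f) = f].
  move=> fe; have [fs ft Ff] := below f fe.
  by have [B1 _ d1] := restrP Bs fs; have [B2 _ d2] := corestrP Bt ft; rewrite d2 d1.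
have below_prod f : f <~ e -> restr s f * corestr f t <~ s' * t'.
  move=> fe; have [B1 B2 d12 d1] := matched f fe.
  apply: (eo_mul eo) => //; try exact: restrE; try exact: corestrE.
    by rewrite mul_neq0 // d12.
  by rewrite mul_neq0 // st'.
rewrite (down_restr Bs) (down_corestr Bt).
transitivity (\sum_(f <- B | f <~ e) restr s f * corestr f t).
  rewrite mulr_suml (bigID (fun f => f <~ ran t)) /= [X in _ + X]big1_seq ?addr0.
    rewrite -big_filter -[RHS]big_filter.
    have -> : [seq f <- B | (f <~ dom s) && (f <~ ran t)] = [seq f <- B | f <~ e].
      apply: eq_filter => f; apply/andP/idP => [[fs ft]|fe]; first by apply: emax => //; apply: ltF.
      by have [] := below f fe.
    apply: eq_big_seq => f; rewrite mem_filter => /andP[fe Bf].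
    have [fs ft Ff] := below f fe; have [B1 B2 d12 d1] := matched f fe.
    rewrite mulr_sumr (big_rem f) //= ft big1_seq ?addr0 // => g.
    rewrite mem_rem_uniq ?fset_uniq // inE => /andP[gt /andP[gf Bg]].
    have [B3 r3 d3] := corestrP Bt gt.
    by rewrite (gb_mul0 gb) // d3 d1 eq_sym.
  move=> f /andP[/andP[fs /negP nft] Bf]; rewrite mulr_sumr big1_seq // => g /andP[gt Bg].
  have [B1 r1 d1] := restrP Bs fs; have [B3 r3 d3] := corestrP Bt gt.
  by rewrite (gb_mul0 gb) // d1 d3; apply/eqP=> fg; rewrite fg in nft.
apply/esym/down_reindex => // [f g fe ge fg|c cst].
  (* (s|f) is determined by its range, which is the range of the product. *)
  have [B1 B2 d12 d1] := matched f fe; have [B3 B4 d34 d3] := matched g ge.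
  rewrite -d1 -d3; suff -> : restr s f = restr s g by [].
  apply: (ran_below_inj (u := s')); try exact: restrE.
  by rewrite -(ran_mul B1 B2 d12) fg ran_mul.
(* The index of [c] is the domain of the corestriction of [s'] to [ran c]. *)
have rc : ran c <~ ran s' by rewrite -(ran_mul Bs' Bt' st'); apply: ran_mono.
have [Ba as' ra] := corestrP Bs' rc; set a := corestr _ _ in Ba as' ra.
have ae : dom a <~ e by rewrite -ds; apply: dom_mono.
exists (dom a) => //; have [B1 B2 d12 d1] := matched _ ae.
have aE : restr s (dom a) = a by apply: dom_below_inj (restrE _ ae) as' d1.
apply: ran_below_inj (below_prod _ ae) cst _.
by rewrite ran_mul // aE.
Qed.

Lemma is_meet_refl e : e \in F -> is_meet e e e.
Proof. by move=> Fe; split=> //; apply: (eo_refl eo); apply: (gb_sub gb). Qed.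

Lemma is_meet_id e f g : e \in F -> f \in F -> g \in F ->
  is_meet g e f -> bar e * bar f = bar g.
Proof.
move=> Fe Ff Fg [ge gf gmax].
have [Be Bf Bg] := And3 (gb_sub gb Fe) (gb_sub gb Ff) (gb_sub gb Fg).
by rewrite (down_mul Be Bf ge gf (e := g)) ?dom_id ?ran_id ?(gb_idem gb).
Qed.

Lemma down_mul_composable s t : s \in B -> t \in B -> dom s = ran t ->
  bar s * bar t = bar (s * t).
Proof.
move=> Bs Bt st; apply: (down_mul (e := dom s)) => //; try exact: (eo_refl eo).
by rewrite -st; apply/is_meet_refl/(gb_dom gb).
Qed.

Lemma down_inj : {in B &, injective bar}.
Proof.
move=> s t Bs Bt /(gb_indep gb) st; apply: (eo_anti eo).
  by rewrite -st // (eo_refl eo).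
by rewrite st // (eo_refl eo).
Qed.

Lemma exists_meet e f : e \in F -> f \in F -> exists2 g, g \in F & is_meet g e f.
Proof. by move=> Fe Ff; have [g [Fg ge gf gmax]] := eo_meet eo Fe Ff; exists g. Qed.

Lemma down_mul_exists s t : s \in B -> t \in B ->
  exists s' t', [/\ s' <~ s, t' <~ t, dom s' = ran t', s' * t' \in B &
    bar s * bar t = bar (s' * t')].
Proof.
move=> Bs Bt; have [g Fg gst] := exists_meet (gb_dom gb Bs) (gb_ran Bt).
have [gs gt gmax] := gst.
have [Bs' ss ds] := restrP Bs gs; have [Bt' tt rt] := corestrP Bt gt.
exists (restr s g), (corestr g t).
have st' : dom (restr s g) = ran (corestr g t) by rewrite ds rt.
split=> //; first exact: (gb_mul gb).
exact: (down_mul Bs Bt ss tt ds rt).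
Qed.

Lemma down_star s : s \in B ->
  [/\ bar s * bar (star s) = bar (ran s), bar (ran s) * bar s = bar s,
      bar (star s) * bar s = bar (dom s) & bar (dom s) * bar (star s) = bar (star s)].
Proof.
move=> Bs; have Bs' := gb_star gb Bs; have KS := gb_starK gb Bs.
have [Br Bd] := (gb_sub gb (gb_ran Bs), gb_sub gb (gb_dom gb Bs)).
split; rewrite down_mul_composable ?KS ?(gb_regular gb) ?star_regular //.
- by rewrite dom_id // gb_ran.
by rewrite dom_id // (gb_dom gb).
Qed.

(** If [bar s] is idempotent then [s = s' * t'] with [s'] and [t'] below [s].
    Since [s'] has the range of [s] and [t'] has its domain, both are [s]; so
    [s = s * s], and in a groupoid only the identities satisfy this. *)
Lemma down_idem s : s \in B -> bar s * bar s = bar s -> s \in F.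
Proof.
move=> Bs; have [s' [t' [ss ts st' Bst ->]]] := down_mul_exists Bs Bs.
move/(down_inj Bst Bs) => sE; have [Bs' Bt'] := (below_basis ss, below_basis ts).
have sE1 : s' = s by apply: (ran_below_inj ss); rewrite ?(eo_refl eo) // -(ran_mul Bs' Bt' st') sE.
have sE2 : t' = s by apply: (dom_below_inj ts); rewrite ?(eo_refl eo) // -(dom_mul Bs' Bt' st') sE.
rewrite sE1 sE2 in sE st'.
have <- : dom s = s by rewrite -{2}sE mulrA st' (gb_regular gb).
exact: (gb_dom gb).
Qed.

Lemma mem_down_magma s : s \in B -> bar s \in elts (down_magma R).
Proof. by move=> Bs; apply/imfsetP; exists s. Qed.

Lemma down_magmaP x : reflect (exists2 s, s \in B & x = bar s) (x \in elts (down_magma R)).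
Proof. exact: imfsetP. Qed.

(** Associativity is inherited from the ring, [bar (star s)] is inverse to
    [bar s], and idempotents commute because they multiply as meets. *)
Theorem down_inverse_semigroup : B != fset0 -> inverse_semigroup (down_magma R).
Proof.
case/fset0Pn=> b Bb; apply: regular_commuting_inverse => /=.
- by apply/fset0Pn; exists (bar b); apply: mem_down_magma.
- move=> _ _ /down_magmaP[s Bs ->] /down_magmaP[t Bt ->].
  have [s' [t' [_ _ _ Bst ->]]] := down_mul_exists Bs Bt.
  exact: mem_down_magma.
- by move=> x y z _ _ _; rewrite mulrA.
- move=> _ /down_magmaP[s Bs ->]; exists (bar (star s)).
    exact/mem_down_magma/(gb_star gb).
  by have [h1 h2 h3 h4] := down_star Bs; split=> /=; rewrite ?h1 ?h2 ?h3 ?h4.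
move=> _ _ /down_magmaP[s Bs ->] /down_magmaP[t Bt ->] /(down_idem Bs) Fs /(down_idem Bt) Ft.
have [g Fg [gs gt gmax]] := exists_meet Fs Ft.
rewrite (is_meet_id Fs Ft Fg) // (is_meet_id Ft Fs Fg) //; split=> // h Fh ht hs.
exact: gmax.
Qed.

Lemma order_down_magma : order_of (down_magma R) = #|` B|.
Proof. by rewrite /order_of card_in_imfset //= => s t Bs Bt; apply: down_inj. Qed.

Lemma down_D_related e f : e \in F -> f \in F ->
  @D_related (down_magma R) (bar e) (bar f) <->
  exists s, [/\ s \in B, ran s = e & dom s = f].
Proof.
move=> Fe Ff; have [Be Bf] := (gb_sub gb Fe, gb_sub gb Ff).
have isgD : inverse_semigroup (down_magma R).
  by apply: down_inverse_semigroup; apply/fset0Pn; exists e.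
have inv_star s : s \in B -> @mutually_inverse (down_magma R) (bar s) (bar (star s)).
  by move=> Bs; have [h1 h2 h3 h4] := down_star Bs; split=> /=; rewrite ?h1 ?h2 ?h3 ?h4.
split=> [[_ [y [[/down_magmaP[s Bs ->] Dy] xy /= ey fy]]]|[s [Bs <- <-]]].
  have Bs' := gb_star gb Bs; have [h1 h2 h3 h4] := down_star Bs.
  have yE : y = bar (star s).
    by apply: mutually_inverse_unique isgD _ _ _ xy (inv_star s Bs) => //; apply: mem_down_magma.
  exists s; split=> //; apply: down_inj; rewrite ?(gb_sub gb) ?gb_ran ?(gb_dom gb) //.
    by rewrite -h1 -yE.
  by rewrite -h3 -yE.
have Bs' := gb_star gb Bs; have [h1 h2 h3 h4] := down_star Bs.
by exists (bar s), (bar (star s)); split=> //=; [split; apply: mem_down_magma|apply: inv_star].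
Qed.

Lemma down_idempotents_are (d : Order.disp_t) (E : finMeetSemilatticeType d)
    (idm : E -> A) :
  injective idm -> (forall x, x \in F <-> exists a, x = idm a) ->
  (forall a b, (idm a, idm b) \in R <-> (a <= b)%O) ->
  idempotents_are (@Named E (down_magma R) (fun a => bar (idm a))).
Proof.
move=> inj_idm FP ext.
have Fidm a : idm a \in F by apply/FP; exists a.
have Bidm a : idm a \in B by apply: (gb_sub gb).
split=> /= [a b /down_inj-/(_ (Bidm a) (Bidm b))/inj_idm //|x|a b].
  split=> [[/down_magmaP[s Bs ->] /(down_idem Bs)/FP[a ->]]|[a ->]]; first by exists a.
  split; first exact: mem_down_magma.
  exact/(is_meet_id _ _ _ (is_meet_refl _)).
apply/esym/is_meet_id => //; split=> [||h /FP[c ->]]; try by apply/ext; rewrite (leIl, leIr).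
by move=> /ext ca /ext cb; apply/ext; rewrite lexI ca.
Qed.

End GroupoidBasis.

(** * The natural basis *)

Section NaturalBasisTheory.
Local Open Scope fset_scope.
Local Open Scope ring_scope.
Variables (K : fieldType) (d : Order.disp_t) (E : finMeetSemilatticeType d).
Variables (k : nat) (X : k.-tuple {set E}) (G : 'I_k -> finGroupType).

Local Notation A := (blocks K X G).
Local Notation B := (nat_basis K X G).
Local Notation F := (idempotent_basis K X G).
Local Notation u := (@unit_mx K d E k X G).
Local Notation idm := (@id_mx K d E k X G).
Local Notation star := (@star K d E k X G).

Lemma blocksP (x y : A) : (forall i r c h, x i r c h = y i r c h) -> x = y.
Proof.
by move=> xy; apply/ffunP=> i; apply/matrixP=> r c; apply/ffunP=> h; apply: xy.
Qed.

Lemma blocks_addE (x y : A) i r c h : (x + y) i r c h = x i r c h + y i r c h.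
Proof. by rewrite ffunE mxE ffunE. Qed.

Lemma blocks0E i r c h : (0 : A) i r c h = 0.
Proof. by rewrite ffunE mxE ffunE. Qed.

Lemma blocks_sumE (I : Type) (s : seq I) (P : pred I) (f : I -> A) i r c h :
  (\sum_(a <- s | P a) f a) i r c h = \sum_(a <- s | P a) f a i r c h.
Proof.
apply: (big_morph (fun x : A => x i r c h)); last exact: blocks0E.
by move=> x y; apply: blocks_addE.
Qed.

Lemma galg_of_mul (gT : finGroupType) (g h : gT) :
  galg_of K g * galg_of K h = galg_of K (g * h)%g.
Proof.
apply/ffunP=> x; rewrite !ffunE (bigD1 g) //= !ffunE eqxx mul1r big1 ?addr0.
  by rewrite -(inj_eq (mulgI g)) mulKVg.
by move=> y /negPf yg; rewrite !ffunE yg mul0r.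
Qed.

Lemma unit_mx_in i a b (g : G i) r c :
  u a b g i r c =
  if (enum_val r == a) && (enum_val c == b) then galg_of K g else 0.
Proof. by rewrite ffunE dfwith_in mxE. Qed.

Lemma unit_mx_out i j a b (g : G i) : i != j -> u a b g j = 0.
Proof. by move=> ij; rewrite ffunE dfwith_out. Qed.

Lemma blocks_mulE (x y : A) i : (x * y) i = x i *m y i.
Proof. by rewrite ffunE. Qed.

Lemma unit_mx_mul i a b c (g h : G i) : b \in tnth X i ->
  u a b g * u b c h = u a c (g * h)%g.
Proof.
move=> bX; apply/ffunP=> j; rewrite blocks_mulE.
case: (eqVneq i j) => [<-|ij]; last by rewrite !unit_mx_out ?mul0mx.
apply/matrixP=> r s; rewrite mxE (bigD1 (enum_rank_in bX b)) //= big1 ?addr0 => [|t tb].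
  rewrite !unit_mx_in enum_rankK_in // eqxx andbT /=.
  by do 2 case: ifP => _; rewrite ?mul0r ?mulr0 // galg_of_mul.
rewrite !unit_mx_in; have /negPf-> : enum_val t != b; last by rewrite andbF mul0r.
apply: contraNneq tb => tE.
by apply/eqP; rewrite -(enum_valK_in bX t) tE.
Qed.

Lemma unit_mx_mul0 i i' a b b' c (g : G i) (h : G i') : b != b' ->
  u a b g * u b' c h = 0.
Proof.
move=> bb; apply/ffunP=> j; rewrite blocks_mulE [RHS]ffunE.
case: (eqVneq i j) => [ij|ij]; last by rewrite unit_mx_out ?mul0mx.
case: (eqVneq i' j) => [ij'|ij']; last by rewrite (unit_mx_out _ _ _ ij') mulmx0.
subst i i'; apply/matrixP=> r s; rewrite !mxE big1 // => t _.
rewrite !unit_mx_in; case: (enum_val t =P b) => [->|_]; last by rewrite andbF mul0r.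
by rewrite (negPf bb) mulr0.
Qed.

Lemma star_unit_mx i a b (g : G i) : star (u a b g) = u b a g^-1%g.
Proof.
apply: blocksP => j r c h; rewrite ffunE mxE ffunE.
case: (eqVneq i j) => [ij|ij]; last by rewrite !unit_mx_out // !mxE !ffunE.
subst j; rewrite !unit_mx_in andbC; case: ifP => _; rewrite !ffunE //.
by rewrite -(inj_eq invg_inj) invgK.
Qed.

Lemma star0 : star 0 = 0.
Proof. by apply: blocksP => j r c h; rewrite ffunE mxE ffunE !blocks0E. Qed.

Lemma nat_basisP (x : A) :
  reflect (exists i a b (g : G i), [/\ a \in tnth X i, b \in tnth X i & x = u a b g])
    (x \in B).
Proof.
apply: (iffP (imfsetP _ _ _ _)) => [[[i [[a b] g]] /andP[/= aX bX] ->]|].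
  by exists i, a, b, g.
case=> i [a [b [g [aX bX ->]]]].
exists (Tagged (fun i => (E * E * G i)%type) (a, b, g)) => //=.
by rewrite unfold_in /= aX.
Qed.

Lemma mem_nat_basis i a b (g : G i) :
  a \in tnth X i -> b \in tnth X i -> u a b g \in B.
Proof. by move=> aX bX; apply/nat_basisP; exists i, a, b, g. Qed.

(** One coefficient of a basis matrix tells it apart from all the others; the
    injectivity of [unit_mx] and linear independence both come from this. *)
Lemma nat_basis_coef i a b (g : G i) (aX : a \in tnth X i) (bX : b \in tnth X i) x :
  x \in B ->
  x i (enum_rank_in aX a) (enum_rank_in bX b) g = (x == u a b g)%:R.
Proof.
case/nat_basisP=> i' [a' [b' [g' [aX' bX' ->]]]].
have coef1 : u a b g i (enum_rank_in aX a) (enum_rank_in bX b) g = 1.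
  by rewrite unit_mx_in !enum_rankK_in // !eqxx ffunE eqxx.
case: eqP => [->|neq]; first exact: coef1.
case: (eqVneq i' i) => [ii|ii]; last by rewrite unit_mx_out // mxE ffunE.
subst i'; rewrite unit_mx_in !enum_rankK_in //; case: ifP; rewrite ffunE //.
case/andP=> /eqP aa /eqP bb; case: eqP => // gg.
by case: neq; rewrite aa bb gg.
Qed.

Lemma unit_mx_inj i a b (g : G i) i' a' b' (g' : G i') :
  a \in tnth X i -> b \in tnth X i -> u a b g = u a' b' g' ->
  Tagged (fun i => (E * E * G i)%type) (a, b, g) =
  Tagged (fun i => (E * E * G i)%type) (a', b', g').
Proof.
move=> aX bX ug; have := nat_basis_coef g aX bX (mem_nat_basis g aX bX).
rewrite eqxx {1}ug.
case: (eqVneq i' i) => [ii|ii]; last first.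
  by rewrite unit_mx_out // mxE ffunE => /eqP; rewrite eq_sym oner_eq0.
subst i'; rewrite unit_mx_in !enum_rankK_in //; case: ifP => [/andP[/eqP<- /eqP<-]|_].
  rewrite ffunE; case: eqP => [-> //|_] /eqP; by rewrite eq_sym oner_eq0.
by rewrite ffunE => /eqP; rewrite eq_sym oner_eq0.
Qed.

Lemma card_nat_basis :
  #|` B| = (\sum_(i < k) #|tnth X i| ^ 2 * #|G i|)%N.
Proof.
rewrite card_in_imfset /=; last first.
  move=> [i [[a b] g]] [i' [[a' b'] g']] /andP[/= aX bX] _.
  exact: unit_mx_inj.
rewrite -cardE -sum1_card.
pose T i := (E * E * G i)%type : finType.
rewrite (eq_bigr (fun i => \sum_(t : T i | (t.1.1 \in tnth X i) && (t.1.2 \in tnth X i)) 1)%N).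
  by rewrite sig_big_dep; apply: eq_bigl => t.
move=> i _; rewrite sum1_card expnS expn1 -cardsX -cardsT -cardsX -cardsE.
by apply: eq_card => -[[a b] g]; rewrite !inE /= andbT.
Qed.

Lemma unit_mx_sum_indep (P Q : pred A) :
  \sum_(x <- B | P x) x = \sum_(x <- B | Q x) x -> {in B, P =1 Q}.
Proof.
move=> PQ _ /nat_basisP[i [a [b [g [aX bX ->]]]]].
have coefP (P' : pred A) : (\sum_(x <- B | P' x) x) i (enum_rank_in aX a) (enum_rank_in bX b) g
    = (P' (u a b g))%:R.
  rewrite blocks_sumE (big_rem (u a b g)) ?mem_nat_basis //=.
  rewrite big1_seq => [|x /andP[_]].
    rewrite addr0 nat_basis_coef ?mem_nat_basis // eqxx.
    by case: (P' _).
  rewrite mem_rem_uniq ?fset_uniq // inE => /andP[/negPf xu Bx].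
  by rewrite nat_basis_coef // xu.
move/(congr1 (fun x : A => x i (enum_rank_in aX a) (enum_rank_in bX b) g)): PQ.
rewrite !coefP; case: (P _); case: (Q _) => // /eqP; rewrite ?oner_eq0 //.
by rewrite eq_sym oner_eq0.
Qed.

Hypothesis coverX : forall a : E, exists i, a \in tnth X i.
Hypothesis disjX : forall i j (a : E), a \in tnth X i -> a \in tnth X j -> i = j.

Lemma id_mxE i a : a \in tnth X i -> idm a = u a a (1%g : G i).
Proof.
move=> aX; apply/ffunP=> j; case: (eqVneq i j) => [<-|ij].
  by apply/matrixP=> r c; rewrite unit_mx_in ffunE mxE.
rewrite unit_mx_out // ffunE; apply/matrixP=> r c; rewrite !mxE.
case: ifP => // /andP[/eqP ra _]; case/negP: ij; apply/eqP/(disjX aX).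
by rewrite -ra enum_valP.
Qed.

Lemma unit_mx_dom i a b (g : G i) : a \in tnth X i -> b \in tnth X i ->
  star (u a b g) * u a b g = idm b.
Proof. by move=> aX bX; rewrite star_unit_mx unit_mx_mul // mulVg (id_mxE bX). Qed.

Lemma unit_mx_ran i a b (g : G i) : a \in tnth X i -> b \in tnth X i ->
  u a b g * star (u a b g) = idm a.
Proof. by move=> aX bX; rewrite star_unit_mx unit_mx_mul // mulgV (id_mxE aX). Qed.

Lemma id_mx_inj : injective idm.
Proof.
move=> a b; have [i aX] := coverX a; have [j bX] := coverX b.
rewrite (id_mxE aX) (id_mxE bX) => /(unit_mx_inj aX aX).
by move/(congr1 (fun t => (tagged t).1.1)).
Qed.

Lemma mem_idempotent_basis (x : A) : x \in F <-> exists a, x = idm a.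
Proof.
by split=> [/imfsetP[a _ ->]|[a ->]]; [exists a|apply/imfsetP; exists a].
Qed.

Theorem nat_basis_groupoid : groupoid_basis B F star.
Proof.
have mulB i i' a b a' b' (g : G i) (g' : G i') : a \in tnth X i -> b \in tnth X i ->
    a' \in tnth X i' -> b' \in tnth X i' -> b = a' -> exists h : G i,
    [/\ u a b g * u a' b' g' = u a b' h, b' \in tnth X i &
     star (u a' b' g') * star (u a b g) = u b' a h^-1%g].
  move=> aX bX aX' bX' ba; subst a'; have ii := disjX bX aX'; subst i'.
  exists (g * g')%g; split=> //; first exact: unit_mx_mul.
  by rewrite !star_unit_mx unit_mx_mul // invMg.
split.
- move=> _ /nat_basisP[i [a [b [g [aX bX ->]]]]].
  by rewrite star_unit_mx mem_nat_basis.
- by move=> _ /nat_basisP[i [a [b [g [aX bX ->]]]]]; rewrite !star_unit_mx invgK.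
- move=> _ _ /nat_basisP[i [a [b [g [aX bX ->]]]]] /nat_basisP[j [a' [b' [h [aX' bX' ->]]]]].
  case: (eqVneq b a') => [ba|ba].
    have [f [-> bX'i ->]] := mulB _ _ _ _ _ _ g h aX bX aX' bX' ba.
    exact: star_unit_mx.
  by rewrite unit_mx_mul0 // !star_unit_mx unit_mx_mul0 1?eq_sym // star0.
- move=> _ _ /nat_basisP[i [a [b [g [aX bX ->]]]]] /nat_basisP[j [a' [b' [h [aX' bX' ->]]]]].
  rewrite unit_mx_dom // unit_mx_ran // => /id_mx_inj ba.
  have [f [-> bX'i _]] := mulB _ _ _ _ _ _ g h aX bX aX' bX' ba.
  exact: mem_nat_basis.
- move=> _ _ /nat_basisP[i [a [b [g [aX bX ->]]]]] /nat_basisP[j [a' [b' [h [aX' bX' ->]]]]].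
  rewrite unit_mx_dom // unit_mx_ran // (inj_eq id_mx_inj).
  exact: unit_mx_mul0.
- move=> _ /nat_basisP[i [a [b [g [aX bX ->]]]]].
  by rewrite star_unit_mx !unit_mx_mul // mulgV mul1g.
- move=> _ /nat_basisP[i [a [b [g [aX bX ->]]]]].
  by rewrite unit_mx_dom //; apply/mem_idempotent_basis; exists b.
- move=> _ /mem_idempotent_basis[a ->]; have [i aX] := coverX a.
  by rewrite (id_mxE aX) mem_nat_basis.
- move=> _ /mem_idempotent_basis[a ->]; have [i aX] := coverX a.
  by rewrite (id_mxE aX) star_unit_mx invg1.
- move=> _ /mem_idempotent_basis[a ->]; have [i aX] := coverX a.
  by rewrite (id_mxE aX) unit_mx_mul // mulg1.
exact: unit_mx_sum_indep.
Qed.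

(** Only the grouping of the conditions differs. *)
Lemma esn_orderP R : esn_order B F star R <-> partial_order R /\ ESN_conditions R.
Proof.
split=> [[h1 h2 h3 h4 h5 h6 h7 h8 h9]|[[h1 h2 h3 h4] [h5 h6 h7 h8 h9]]].
  by split; split.
by split.
Qed.

Lemma unit_mx_D_related a b :
  (exists x : A, [/\ x \in B, x * star x = idm a & star x * x = idm b]) <->
  exists i, a \in tnth X i /\ b \in tnth X i.
Proof.
split=> [[_ [/nat_basisP[i [a' [b' [g [aX bX ->]]]]]]]|[i [aX bX]]].
  rewrite unit_mx_ran // unit_mx_dom // => /id_mx_inj <- /id_mx_inj <-.
  by exists i.
by exists (u a b (1%g : G i)); rewrite mem_nat_basis // unit_mx_ran ?unit_mx_dom.
Qed.

End NaturalBasisTheory.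

(** * Invariants of isomorphism *)

Section Invariance.
Local Open Scope fset_scope.
Variables (d : Order.disp_t) (E E' : finMeetSemilatticeType d).

(** The map [phi] carries the blocks of [P] onto those of [P'], since blocks are
    the classes of the relations that it respects. *)
Lemma shape_of_bij (phi : E -> E') (P : {set {set E}}) (P' : {set {set E'}}) :
  bijective phi -> partition P [set: E] -> partition P' [set: E'] ->
  (forall a b, pblock P a = pblock P b <-> pblock P' (phi a) = pblock P' (phi b)) ->
  shape_of P = shape_of P'.
Proof.
move=> bij_phi pP pP' PP'; have inj_phi := bij_inj bij_phi.
have [phi' phiK phiK'] := bij_phi.
have cov a : a \in cover P by rewrite (cover_partition pP) inE.
have cov' a : a \in cover P' by rewrite (cover_partition pP') inE.
have [_ tP _] := and3P pP; have [_ tP' _] := and3P pP'.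
have img a : phi @: pblock P a = pblock P' (phi a).
  apply/setP=> c; rewrite -[c]phiK' (mem_imset _ _ inj_phi).
  rewrite -eq_pblock // -eq_pblock //; apply/eqP/eqP; exact: (PP' _ _).1 || exact: (PP' _ _).2.
have blockP (F : finMeetSemilatticeType d) (Q : {set {set F}}) Y : partition Q [set: F] ->
    Y \in Q -> exists a, Y = pblock Q a.
  case/and3P=> _ tQ Q0 QY; have /set0Pn[a Ya] : Y != set0 by apply: contraNneq Q0 => <-.
  by exists a; rewrite (def_pblock tQ QY Ya).
apply/perm_sortP; [by move=> x y; apply: leq_total|by move=> y x z /= yx zy; apply: leq_trans yx|by move=> x y; rewrite andbC; apply: anti_leq|].
have -> : [seq #|Y| | Y : {set E} <- enum P] =
    [seq #|Z| | Z : {set E'} <- [seq phi @: Y | Y : {set E} <- enum P]].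
  by rewrite -map_comp; apply: eq_map => Y /=; rewrite card_imset.
apply: perm_map; apply: uniq_perm; rewrite ?enum_uniq //.
  rewrite map_inj_uniq ?enum_uniq //; exact: imset_inj.
move=> Z; rewrite mem_enum; apply/mapP/idP => [[Y]|P'Z].
  rewrite mem_enum => /(blockP _ _ _ pP)[a ->] ->; rewrite img.
  exact: pblock_mem.
have [c cE] := blockP _ _ _ pP' P'Z; exists (pblock P (phi' c)).
  by rewrite mem_enum pblock_mem.
by rewrite img phiK'.
Qed.

Definition D_partition_of (F : finMeetSemilatticeType d) (S : named F)
    (P : {set {set F}}) : Prop :=
  partition P [set: F] /\
  forall a b, pblock P a = pblock P b <-> D_related (label S a) (label S b).

Lemma label_elt (F : finMeetSemilatticeType d) (S : named F) a :
  idempotents_are S -> label S a \in elts S.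
Proof. by case=> _ id _; have [] := (id (label S a)).2 (ex_intro _ a erefl). Qed.

(** Idempotents, their products and the relation D are defined by equations in
    the semigroup, so that an isomorphism induces an isomorphism of semilattices
    of labels which respects the D-classes. *)
Lemma isomorphic_invariants (S : named E) (S' : named E') P P' :
  inverse_semigroup S -> inverse_semigroup S' ->
  idempotents_are S -> idempotents_are S' ->
  D_partition_of S P -> D_partition_of S' P' -> isomorphic S S' ->
  semilattice_iso E E' /\ shape_of P = shape_of P'.
Proof.
move=> isgS isgS' idS idS' [pP DP] [pP' DP'] [phi [inj im mor]].
have [injl idl morl] := idS; have [injl' idl' morl'] := idS'.
have lS a := label_elt a idS; have lS' a := label_elt a idS'.
have Sphi x : x \in elts S -> phi x \in elts S'.
  by move=> Sx; rewrite -im; apply/imfsetP; exists x.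
have [f fP] : {f & forall a, phi (label S a) = label S' (f a)}.
  apply: (@choice _ _ (fun a b => phi (label S a) = label S' b)) => a.
  have [Sa aa] := (idl (label S a)).2 (ex_intro _ a erefl).
  by apply/idl'; rewrite -mor // aa Sphi.
have [g gP] : {g & forall b, label S' b = phi (label S (g b))}.
  apply: (@choice _ _ (fun b a => label S' b = phi (label S a))) => b.
  have [S'b bb] := (idl' (label S' b)).2 (ex_intro _ b erefl).
  move: (S'b); rewrite -{1}im => /imfsetP[x Sx xb].
  have [a xa] : exists a, x = label S a.
    apply/idl; split=> //; apply: inj => //; first by have [_ cl _ _] := isgS; apply: cl.
    by rewrite mor // -xb.
  by exists a; rewrite -xa.
have bij_f : bijective f.
  exists g => a; last by apply: injl'; rewrite -fP gP.
  by apply: injl; apply: inj => //; rewrite -gP fP.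
split; first exists f => // a b.
  by apply: injl'; rewrite -fP morl morl' mor // !fP.
apply: (shape_of_bij bij_f pP pP') => a b; rewrite DP DP' -!fP.
split=> [[x [y [[Sx Sy] [xy yx] xa yb]]]|[x [y [[]]]]].
  exists (phi x), (phi y); split; rewrite ?Sphi -?mor ?xa ?yb //.
  by split; rewrite -?mor ?xa ?yb -?xa -?yb ?xy ?yx //; have [_ cl _ _] := isgS; apply: cl.
rewrite -{1 2}im => /imfsetP[x' Sx ->] /imfsetP[y' Sy ->] [xy yx] xa yb.
have [_ cl _ _] := isgS.
rewrite -!mor ?cl // in xy yx xa yb.
exists x', y'; split=> //; [split; apply: inj| apply: inj | apply: inj]; rewrite ?cl //.
Qed.

End Invariance.

(** * The natural order of an inverse semigroup *)

(** Operations that are total on a finite type, so that computations carry no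
    membership hypotheses. *)
Record invSemigroup := InvSemigroup {
  isg_car :> finType;
  imul : isg_car -> isg_car -> isg_car;
  iinv : isg_car -> isg_car;
  imulA : associative imul;
  imulVK : forall x, imul (imul x (iinv x)) x = x;
  iinvK : involutive iinv;
  iinv_uniq : forall x y,
    imul (imul x y) x = x -> imul (imul y x) y = y -> y = iinv x
}.

Declare Scope isg_scope.
Delimit Scope isg_scope with isg.
Notation "x * y" := (imul x y) : isg_scope.
Notation "x ^-1" := (iinv x) : isg_scope.


Section InverseSemigroups.
Local Open Scope isg_scope.
Variable T : invSemigroup.
Implicit Types x y z e f s t : T.

Definition idem e : bool := e * e == e.
Definition idom x : T := x^-1 * x.
Definition iran x : T := x * x^-1.
Definition natle x y : bool := x == y * idom x.

Lemma imulKV x : x^-1 * x * x^-1 = x^-1.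
Proof. by rewrite -{2}(iinvK x) imulVK. Qed.

Lemma idem_inv e : idem e -> e^-1 = e.
Proof. by move=> /eqP ee; apply/esym/iinv_uniq; rewrite !ee. Qed.

Lemma idem_idom x : idem (idom x).
Proof. by rewrite /idem /idom imulA imulKV. Qed.

Lemma idem_iran x : idem (iran x).
Proof. by rewrite /idem /iran imulA imulVK. Qed.

(** With [z] the inverse of [e f], the element [f z e] is an idempotent and an
    inverse of [e f], so it is [z]; the inverse [e f] of this idempotent is
    therefore idempotent as well. *)
Lemma idem_mul e f : idem e -> idem f -> idem (e * f).
Proof.
move=> /eqP ee /eqP ff; set z := (e * f)^-1.
have zE : f * z * e = z.
  apply: iinv_uniq.
    rewrite -[RHS](imulVK (e * f)) -/z !imulA -(imulA e f f) ff.
    by rewrite -(imulA _ e e) ee.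
  rewrite !imulA -(imulA _ e e) ee -(imulA _ f f) ff -!imulA; congr (f * _).
  by rewrite !imulA -(imulA z) imulKV.
have zz : idem z.
  rewrite /idem -{1 2}zE !imulA -(imulA _ e f) -!imulA; apply/eqP.
  by rewrite -[RHS]zE -imulA; congr (f * _); rewrite !imulA -(imulA z) imulKV.
by rewrite -[e * f]iinvK -/z (idem_inv zz).
Qed.

Lemma idem_comm e f : idem e -> idem f -> e * f = f * e.
Proof.
move=> ie iif; have /eqP ief := idem_mul ie iif; have /eqP ife := idem_mul iif ie.
have /eqP ee := ie; have /eqP ff := iif.
rewrite -[LHS](idem_inv (idem_mul ie iif)); apply/esym/iinv_uniq.
  by rewrite !imulA -(imulA e f f) ff -(imulA _ e e) ee -imulA.
by rewrite !imulA -(imulA f e e) ee -(imulA _ f f) ff -imulA.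
Qed.

Lemma iinvM x y : (x * y)^-1 = y^-1 * x^-1.
Proof.
apply/esym/iinv_uniq.
  transitivity (x * (iran y * idom x) * y); first by rewrite /iran /idom !imulA.
  rewrite (idem_comm (idem_iran y) (idem_idom x)) /iran /idom !imulA imulVK.
  by rewrite -!imulA (imulA y) imulVK.
transitivity (y^-1 * (idom x * iran y) * x^-1); first by rewrite /iran /idom !imulA.
rewrite (idem_comm (idem_idom x) (idem_iran y)) /iran /idom !imulA imulKV.
by rewrite -!imulA (imulA x^-1) imulKV.
Qed.

Lemma idom_inv x : idom x^-1 = iran x.
Proof. by rewrite /idom iinvK. Qed.

Lemma iran_inv x : iran x^-1 = idom x.
Proof. by rewrite /iran iinvK. Qed.

Lemma idom_idem e : idem e -> idom e = e.
Proof. by move=> ie; rewrite /idom idem_inv //; apply/eqP. Qed.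

Lemma iran_idem e : idem e -> iran e = e.
Proof. by move=> ie; rewrite /iran idem_inv //; apply/eqP. Qed.

Lemma imul_idom x : x * idom x = x.
Proof. by rewrite /idom imulA imulVK. Qed.

Lemma iran_imul x : iran x * x = x.
Proof. exact: imulVK. Qed.

Lemma idem_conj x e : idem e -> idem (x^-1 * e * x).
Proof.
move=> ie; rewrite /idem !imulA -(imulA _ x x^-1) -/(iran x) -(imulA _ e (iran x)).
rewrite (idem_comm ie (idem_iran x)) -!imulA (imulA e e) (eqP ie) /iran.
by rewrite !imulA imulKV.
Qed.

(** An idempotent moves to the other side of [x] because it commutes with
    [x * x^-1]. *)
Lemma idem_mulC x e : idem e -> e * x = x * (x^-1 * e * x).
Proof.
move=> ie; rewrite !imulA -/(iran x) (idem_comm (idem_iran x) ie).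
by rewrite -imulA iran_imul.
Qed.

Lemma natle_idemr x y e : idem e -> x = y * e -> natle x y.
Proof.
move=> ie ->; rewrite /natle /idom iinvM (idem_inv ie); apply/eqP.
rewrite !imulA -(imulA _ e y^-1) (_ : y * (e * y^-1) * y = y * (e * idom y)).
  by rewrite (idem_comm ie (idem_idom y)) imulA imul_idom -imulA (eqP ie).
by rewrite /idom !imulA.
Qed.

(** The natural order can be written with an idempotent factor on either side;
    compatibility with products and inverses follows from this symmetry. *)
Lemma natle_idemrP x y : reflect (exists2 e, idem e & x = y * e) (natle x y).
Proof.
apply: (iffP idP) => [/eqP xy|[e ie]]; last exact: natle_idemr.
by exists (idom x); rewrite ?idem_idom.
Qed.

Lemma natle_idemlP x y : reflect (exists2 e, idem e & x = e * y) (natle x y).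
Proof.
apply: (iffP (natle_idemrP x y)) => [[e ie ->]|[e ie ->]].
  exists (y * e * y^-1); last first.
    by rewrite -!imulA -/(idom y) (idem_comm ie (idem_idom y)) imulA imul_idom.
  by have := idem_conj y^-1 ie; rewrite iinvK.
by exists (y^-1 * e * y); [apply: idem_conj|apply: idem_mulC].
Qed.

Lemma natle_refl x : natle x x.
Proof. by rewrite /natle imul_idom. Qed.

Lemma natle_trans y x z : natle x y -> natle y z -> natle x z.
Proof.
move=> /natle_idemrP[e ie ->] /natle_idemrP[f iif ->]; apply/natle_idemrP.
by exists (f * e); rewrite ?idem_mul ?imulA.
Qed.

Lemma natle_anti x y : natle x y -> natle y x -> x = y.
Proof.
move=> /[dup] xy /eqP xE /eqP yE.
rewrite xE {1}yE -imulA (idem_comm (idem_idom y) (idem_idom x)) imulA.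
by rewrite imul_idom -yE.
Qed.

Lemma natle_inv x y : natle x y -> natle x^-1 y^-1.
Proof.
move=> /natle_idemrP[e ie ->]; apply/natle_idemlP; exists e => //.
by rewrite iinvM (idem_inv ie).
Qed.

Lemma natle_mul x y z t : natle x y -> natle z t -> natle (x * z) (y * t).
Proof.
move=> /natle_idemrP[e ie ->] /natle_idemrP[f iif ->]; apply/natle_idemrP.
exists (t^-1 * e * t * f); first by rewrite idem_mul ?idem_conj.
by rewrite !imulA -(imulA y e t) (idem_mulC t ie) !imulA.
Qed.

Lemma natle_idem e f : idem e -> natle e f -> e = f * e.
Proof. by move=> ie /eqP {1}->; rewrite idom_idem. Qed.

Lemma idem_natle e f : natle e f -> idem f -> idem e.
Proof. by move=> /natle_idemrP[g ig ->] iif; apply: idem_mul. Qed.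

Lemma idem_meet e f : idem e -> idem f ->
  [/\ natle (e * f) e, natle (e * f) f &
      forall g, natle g e -> natle g f -> natle g (e * f)].
Proof.
move=> ie iif; split=> [||g ge gf]; first by apply/natle_idemrP; exists f.
  by apply/natle_idemlP; exists e.
have ig := idem_natle ge ie.
apply/natle_idemrP; exists g => //.
by rewrite -imulA -(natle_idem ig gf) -(natle_idem ig ge).
Qed.

Lemma idom_restr s e : idem e -> natle e (idom s) -> idom (s * e) = e.
Proof.
move=> ie es; rewrite /idom iinvM (idem_inv ie) -imulA (imulA s^-1) -/(idom s).
by rewrite -(natle_idem ie es) (eqP ie).
Qed.

Lemma iran_corestr s e : idem e -> natle e (iran s) -> iran (e * s) = e.
Proof.
move=> ie es; rewrite /iran iinvM (idem_inv ie) imulA -(imulA e s) -/(iran s).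
by rewrite -imulA -(natle_idem ie es) (eqP ie).
Qed.

Lemma natle_restr s t : natle t s -> t = s * idom t.
Proof. by move/eqP. Qed.

Lemma natle_corestr s t : natle t s -> t = iran t * s.
Proof. by move/natle_inv/eqP/(congr1 (@iinv T)); rewrite iinvM !iinvK idom_inv (idem_inv (idem_iran t)). Qed.

Lemma idom_mul x y : idom x = iran y -> idom (x * y) = idom y.
Proof.
move=> xy; rewrite /idom iinvM !imulA -(imulA y^-1) -/(idom x) xy.
by rewrite -imulA iran_imul.
Qed.

Lemma iran_mul x y : idom x = iran y -> iran (x * y) = iran x.
Proof.
move=> xy; rewrite /iran iinvM !imulA -(imulA x) -/(iran y) -xy.
by rewrite imul_idom.
Qed.

End InverseSemigroups.

(** * The natural order carried over to a basis *)

Section Transport.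
Local Open Scope isg_scope.
Variables (A : pzRingType) (B F : {fset A}) (star : A -> A).
Hypothesis gb : groupoid_basis B F star.
Variables (T : invSemigroup) (psi : T -> A).
(* [psi] identifies [B] with the groupoid that [T] becomes when only the
   products [s * t] with [idom s = iran t] are kept. *)
Hypothesis psi_inj : injective psi.
Hypothesis psi_img : forall x, x \in B <-> exists s, x = psi s.
Hypothesis psi_star : forall s, psi s^-1 = star (psi s).
Hypothesis psi_mul : forall s t, idom s = iran t -> psi (s * t) = (psi s * psi t)%R.

Definition transported_order : {fset A * A} :=
  [fset (psi p.1, psi p.2) | p in [pred p : T * T | natle p.1 p.2]]%fset.
Local Notation R := transported_order.

Lemma psi_basis s : psi s \in B.
Proof. by apply/psi_img; exists s. Qed.

Lemma transported_orderE s t : ((psi s, psi t) \in R) = natle s t.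
Proof.
apply/imfsetP/idP => [[[s' t'] /= st [/psi_inj -> /psi_inj ->]] //|st].
by exists (s, t).
Qed.

Lemma transported_orderP x y : (x, y) \in R ->
  exists s t, [/\ x = psi s, y = psi t & natle s t].
Proof. by case/imfsetP=> -[s t] /= st [-> ->]; exists s, t. Qed.

Lemma psi_idom s : (star (psi s) * psi s)%R = psi (idom s).
Proof. by rewrite -psi_star -psi_mul // idom_inv. Qed.

Lemma psi_iran s : (psi s * star (psi s))%R = psi (iran s).
Proof. by rewrite -psi_star -psi_mul // iran_inv. Qed.

Lemma psi_idemP x : x \in F <-> exists2 e, idem e & x = psi e.
Proof.
split=> [Fx|[e ie ->]].
  have /psi_img[s sE] := gb_sub gb Fx; exists (idom s); first exact: idem_idom.
  by rewrite -psi_idom -sE (dom_id gb).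
by have := gb_dom gb (psi_basis e); rewrite psi_idom idom_idem.
Qed.

Theorem transported_esn_order : esn_order B F star R.
Proof.
split.
- by move=> x y /transported_orderP[s [t [-> -> _]]]; rewrite !psi_basis.
- by move=> _ /psi_img[s ->]; rewrite transported_orderE natle_refl.
- move=> _ _ /transported_orderP[s [t [-> -> st]]]; rewrite transported_orderE.
  by move/(natle_anti st) ->.
- move=> _ _ y /transported_orderP[s [t [-> -> st]]].
  case/transported_orderP=> t' [z [/psi_inj <- -> tz]].
  by rewrite transported_orderE (natle_trans st tz).
- move=> _ _ /psi_idemP[e ie ->] /psi_idemP[f iif ->].
  have [ef1 ef2 efmax] := idem_meet ie iif.
  exists (psi (e * f)); split; rewrite ?transported_orderE //.
    by apply/psi_idemP; exists (e * f) => //; apply: idem_mul.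
  by move=> _ /psi_idemP[g ig ->]; rewrite !transported_orderE; apply: efmax.
- move=> _ _ /psi_img[s ->] /psi_img[t ->].
  by rewrite -!psi_star !transported_orderE; apply: natle_inv.
- move=> _ _ _ _ /psi_img[s ->] /psi_img[t ->] /psi_img[y ->] /psi_img[z ->].
  rewrite !transported_orderE => sy tz.
  rewrite !(mul_neq0 gb) ?psi_basis // !psi_idom !psi_iran.
  move=> /eqP/psi_inj st /eqP/psi_inj yz.
  by rewrite -!psi_mul // transported_orderE natle_mul.
- move=> _ _ /psi_img[e ->] /psi_img[s ->].
  rewrite psi_idom transported_orderE => es.
  have ie := idem_natle es (idem_idom s).
  exists (psi (s * e)); split.
    rewrite psi_basis transported_orderE psi_idom idom_restr //; split=> //.
    exact: natle_idemr ie _.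
  move=> _ [/psi_img[t ->]]; rewrite transported_orderE psi_idom => ts /psi_inj <-.
  by rewrite -natle_restr.
move=> _ _ /psi_img[e ->] /psi_img[s ->].
rewrite psi_iran transported_orderE => es.
have ie := idem_natle es (idem_iran s).
exists (psi (e * s)); split.
  rewrite psi_basis transported_orderE psi_iran iran_corestr //; split=> //.
  by apply/natle_idemlP; exists e.
move=> _ [/psi_img[t ->]]; rewrite transported_orderE psi_iran => ts /psi_inj <-.
by rewrite -natle_corestr.
Qed.

(** With [e = idom s * iran t], the restrictions of [s] and [t] to [e] are
    [s * e] and [e * t], and [s * e * (e * t) = s * t]. Hence the pseudoproduct
    recovers the product of [T]. *)
Lemma transported_mul s t :
  (down B R (psi s) * down B R (psi t))%R = down B R (psi (s * t)).
Proof.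
set e := idom s * iran t.
have [es et emax] := idem_meet (idem_idom s) (idem_iran t).
have ie : idem e by apply: idem_mul; rewrite ?idem_idom ?idem_iran.
have dse : idom (s * e) = e by apply: idom_restr.
have ret : iran (e * t) = e by apply: iran_corestr.
have -> : psi (s * t) = (psi (s * e)%isg * psi (e * t)%isg)%R.
  rewrite -psi_mul ?dse ?ret //; congr psi.
  by rewrite imulA -(imulA s e e) (eqP ie) /e (imulA s (idom s)) imul_idom -imulA iran_imul.
apply: (down_mul gb transported_esn_order (e := psi e)); rewrite ?psi_basis //.
- by rewrite transported_orderE; apply: natle_idemr ie _.
- by rewrite transported_orderE; apply/natle_idemlP; exists e.
- by rewrite psi_idom dse.
- by rewrite psi_iran ret.
rewrite psi_idom psi_iran /is_meet !transported_orderE; split=> // _ /psi_idemP[g _ ->].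
by rewrite !transported_orderE; apply: emax.
Qed.

Lemma transported_inj : injective (fun s => down B R (psi s)).
Proof.
by move=> s t /(down_inj gb transported_esn_order (psi_basis s) (psi_basis t))/psi_inj.
Qed.

End Transport.

(** * Idempotents and maximal subgroups *)

Section Carrier.
Local Open Scope fset_scope.
Variables (S : fmagma) (isgS : inverse_semigroup S).

Fact carrier_mul_subproof (x y : elts S) : op (val x) (val y) \in elts S.
Proof. by have [_ cl _ _] := isgS; apply: cl; apply: valP. Qed.

Definition carrier_mul (x y : elts S) : elts S := [` carrier_mul_subproof x y].

Fact carrier_mulA : associative carrier_mul.
Proof. by have [_ _ asc _] := isgS; move=> x y z; apply: val_inj; apply: asc; apply: valP. Qed.

Fact carrier_inv_subproof (x : elts S) : exists y : elts S,
  [/\ carrier_mul (carrier_mul x y) x = x, carrier_mul (carrier_mul y x) y = y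
    & forall z, carrier_mul (carrier_mul x z) x = x ->
                carrier_mul (carrier_mul z x) z = z -> z = y].
Proof.
have [_ _ _ /(_ (val x) (valP x))[y [[Sy xyx yxy] uniqy]]] := isgS.
exists [` Sy]; split; try exact: val_inj.
move=> z /(congr1 val) xzx /(congr1 val) zxz.
by apply: val_inj; rewrite /= -(uniqy (val z)) // (valP z).
Qed.

Definition carrier_inv (x : elts S) : elts S := projT1 (cid (carrier_inv_subproof x)).

Lemma carrier_invP (x : elts S) :
  [/\ carrier_mul (carrier_mul x (carrier_inv x)) x = x,
      carrier_mul (carrier_mul (carrier_inv x) x) (carrier_inv x) = carrier_inv x
    & forall z, carrier_mul (carrier_mul x z) x = x ->
                carrier_mul (carrier_mul z x) z = z -> z = carrier_inv x].
Proof. exact: (projT2 (cid (carrier_inv_subproof x))). Qed.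

Definition carrier_isg : invSemigroup.
Proof.
refine (@InvSemigroup (elts S) carrier_mul carrier_inv carrier_mulA _ _ _).
- by move=> x; have [] := carrier_invP x.
- by move=> x; have [h1 h2 _] := carrier_invP x; have [_ _ h] := carrier_invP (carrier_inv x);
    apply/esym/h.
by move=> x; have [_ _] := carrier_invP x.
Defined.

End Carrier.

Section IdempotentSemilattice.
Variables (d : Order.disp_t) (T : invSemigroup).

(** The display is an argument, so that the order can be declared canonical for
    any display. *)
Definition idem_type (_ : Order.disp_t) : Type := {e : T | idem e}.
Local Notation I := (idem_type d).

HB.instance Definition _ := Finite.on I.

Definition idem_le (e f : I) : bool := natle (val e) (val f).
Definition idem_meet_op (e f : I) : I := Sub (imul (val e) (val f)) (idem_mul (valP e) (valP f)).

Fact idem_le_refl : reflexive idem_le.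
Proof. by move=> e; apply: natle_refl. Qed.
Fact idem_le_anti : antisymmetric idem_le.
Proof. by move=> e f /andP[ef fe]; apply/val_inj/natle_anti. Qed.
Fact idem_le_trans : transitive idem_le.
Proof. by move=> f e g; apply: natle_trans. Qed.
HB.instance Definition _ :=
  Order.Le_isPOrder.Build d I idem_le_refl idem_le_anti idem_le_trans.

Fact idem_lexI (e f g : I) : (e <= idem_meet_op f g)%O = (e <= f)%O && (e <= g)%O.
Proof.
have [h1 h2 h3] := idem_meet (valP f) (valP g).
apply/idP/andP => [efg|[ef eg]]; last exact: h3.
by split; [apply: natle_trans efg h1|apply: natle_trans efg h2].
Qed.
HB.instance Definition _ := Order.POrder_isMeetSemilattice.Build d I idem_lexI.

Definition idem_semilattice : finMeetSemilatticeType d := I.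

End IdempotentSemilattice.

Section MaximalSubgroup.
Variables (T : invSemigroup) (e : T).
Hypothesis ie : idem e.

Definition in_max_subgroup (x : T) : bool := (idom x == e) && (iran x == e).
Definition max_subgroup : Type := {x : T | in_max_subgroup x}.
HB.instance Definition _ := Finite.on max_subgroup.
Implicit Types x y : max_subgroup.

Lemma max_subgroupP x : idom (val x) = e /\ iran (val x) = e.
Proof. by have /andP[/eqP-> /eqP->] := valP x. Qed.

Fact max_mul_subproof x y : in_max_subgroup (imul (val x) (val y)).
Proof.
rewrite /in_max_subgroup.
have [[dx rx] [dy ry]] := (max_subgroupP x, max_subgroupP y).
by rewrite idom_mul ?iran_mul ?dx ?ry // rx dy !eqxx.
Qed.
Fact max_one_subproof : in_max_subgroup e.
Proof. by rewrite /in_max_subgroup idom_idem ?iran_idem ?eqxx. Qed.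
Fact max_inv_subproof x : in_max_subgroup (iinv (val x)).
Proof.
by have [dx rx] := max_subgroupP x; rewrite /in_max_subgroup idom_inv iran_inv dx rx !eqxx.
Qed.

Definition max_mul x y : max_subgroup := exist in_max_subgroup _ (max_mul_subproof x y).
Definition max_one : max_subgroup := exist in_max_subgroup e max_one_subproof.
Definition max_inv x : max_subgroup := exist in_max_subgroup _ (max_inv_subproof x).

Fact max_mulA : associative max_mul.
Proof. by move=> x y z; apply/val_inj/imulA. Qed.
Fact max_mul1 : left_id max_one max_mul.
Proof.
move=> x; apply: val_inj; rewrite /=; have [_ rx] := max_subgroupP x.
by rewrite -{1}rx iran_imul.
Qed.
Fact max_mulV : left_inverse max_one max_inv max_mul.
Proof. by move=> x; apply: val_inj; have [dx _] := max_subgroupP x. Qed.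

HB.instance Definition _ :=
  Finite_isGroup.Build max_subgroup max_mulA max_mul1 max_mulV.

Definition max_subgroup_group : finGroupType := max_subgroup.

End MaximalSubgroup.

(** * Matrix coordinates on an inverse semigroup *)

Section Coordinates.
Local Open Scope isg_scope.
Variables (K : fieldType) (d : Order.disp_t) (E : finMeetSemilatticeType d).
Variables (k : nat) (X : k.-tuple {set E}) (G : 'I_k -> finGroupType).
Variables (T : invSemigroup) (eps : E -> T).
Hypothesis coverX : forall a : E, exists i, a \in tnth X i.
Hypothesis disjX : forall i j (a : E), a \in tnth X i -> a \in tnth X j -> i = j.
Hypothesis eps_inj : injective eps.
Hypothesis eps_idem : forall e, idem e <-> exists a, e = eps a.
Hypothesis eps_meet : forall a b, eps (a `&` b)%O = eps a * eps b.

Variables (base : 'I_k -> E) (gam : forall i, G i -> T).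
Hypothesis base_block : forall i, base i \in tnth X i.
Hypothesis gam_inj : forall i, injective (@gam i).
Hypothesis gam_mul : forall i (g h : G i), gam (g * h)%g = gam g * gam h.
Hypothesis gam_img : forall i x,
  idom x = eps (base i) /\ iran x = eps (base i) <-> exists g : G i, x = gam g.

(* The idempotents [rn x] and [dm x] are the two ends of [x], which lie in the
   same block, and [conn a] is a chosen element from the base point of the block
   of [a] to [a]. *)
Variables (rn dm : T -> E) (blk : E -> 'I_k) (conn : E -> T).
Variable ginv : forall i, T -> G i.
Hypothesis rnE : forall x, eps (rn x) = iran x.
Hypothesis dmE : forall x, eps (dm x) = idom x.
Hypothesis blkP : forall a, a \in tnth X (blk a).
Hypothesis blk_rn_dm : forall x, blk (rn x) = blk (dm x).
Hypothesis connP : forall a, iran (conn a) = eps a /\ idom (conn a) = eps (base (blk a)).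
Hypothesis ginvK : forall i (g : G i), ginv i (gam g) = g.

Local Notation A := (blocks K X G).
Local Notation B := (nat_basis K X G).
Local Notation F := (idempotent_basis K X G).
Local Notation u := (@unit_mx K d E k X G).
Local Notation idm := (@id_mx K d E k X G).
Local Notation star := (@star K d E k X G).

(** Writing [x] as [conn a * g * (conn b)^-1] with [g] in the maximal subgroup
    at the base point, [to_base x] is [g], and [coord x] is the matrix with [g]
    in position (a,b). *)
Definition to_base (x : T) : T := (conn (rn x))^-1 * x * conn (dm x).

Definition coord (x : T) : A :=
  u (rn x) (dm x) (ginv (blk (rn x)) (to_base x)).

Lemma to_base_ends x :
  idom (to_base x) = eps (base (blk (rn x))) /\ iran (to_base x) = eps (base (blk (rn x))).
Proof.
have [rr dr] := connP (rn x); have [rd dd] := connP (dm x).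
have h1 : idom (conn (rn x))^-1 = iran x by rewrite idom_inv rr rnE.
have h2 : idom ((conn (rn x))^-1 * x) = iran (conn (dm x)) by rewrite idom_mul // rd dmE.
by rewrite /to_base idom_mul // iran_mul // iran_mul // iran_inv dr dd blk_rn_dm.
Qed.

Lemma from_base x : x = conn (rn x) * to_base x * (conn (dm x))^-1.
Proof.
have [rr _] := connP (rn x); have [rd _] := connP (dm x).
rewrite /to_base -!imulA -/(iran (conn (dm x))) rd dmE imul_idom imulA.
by rewrite -/(iran (conn (rn x))) rr rnE iran_imul.
Qed.

Lemma gam_ginv i x : idom x = eps (base i) -> iran x = eps (base i) ->
  gam (ginv i x) = x.
Proof. by move=> dx rx; have [g ->] := (gam_img i x).1 (conj dx rx); rewrite ginvK. Qed.

Lemma gam_to_base x : gam (ginv (blk (rn x)) (to_base x)) = to_base x.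
Proof. by have [dx rx] := to_base_ends x; apply: gam_ginv. Qed.

Lemma gam_inv i (g : G i) : gam g^-1%g = (gam g)^-1.
Proof. by apply: iinv_uniq; rewrite -!gam_mul ?mulgV ?mulVg mul1g. Qed.

Lemma gam_one i : gam (1%g : G i) = eps (base i).
Proof.
have [<- _] : idom (gam (1%g : G i)) = eps (base i) /\ iran (gam (1%g : G i)) = eps (base i).
  by apply/gam_img; exists 1%g.
by rewrite /idom -gam_inv -gam_mul mulVg.
Qed.

Lemma dm_block x : dm x \in tnth X (blk (rn x)).
Proof. by rewrite blk_rn_dm. Qed.

Lemma coord_inj : injective coord.
Proof.
move=> x y /(unit_mx_inj (blkP _) (dm_block x)) xy.
have rxy : rn x = rn y := congr1 (fun t => (tagged t).1.1) xy.
have dxy : dm x = dm y := congr1 (fun t => (tagged t).1.2) xy.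
have := congr1 (fun t => gam (tagged t).2) xy.
rewrite /= !gam_to_base => bxy.
by rewrite (from_base x) (from_base y) bxy rxy dxy.
Qed.

Lemma coordE x i a b c : rn x = a -> dm x = b -> blk a = i -> to_base x = c ->
  coord x = u a b (ginv i c).
Proof. by rewrite /coord => -> -> -> ->. Qed.

Lemma mem_coord x : coord x \in B.
Proof. by apply: mem_nat_basis; [apply: blkP|apply: dm_block]. Qed.

Lemma coord_img z : z \in B <-> exists x, z = coord x.
Proof.
split=> [/nat_basisP[i [a [b [g [aX bX ->]]]]]|[x ->]]; last exact: mem_coord.
have ia : blk a = i := disjX (blkP a) aX.
have ib : blk b = i := disjX (blkP b) bX.
have [ra da] := connP a; have [rb db] := connP b.
have [dg rg] : idom (gam g) = eps (base i) /\ iran (gam g) = eps (base i).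
  by apply/gam_img; exists g.
have h1 : idom (conn a) = iran (gam g) by rewrite da ia.
have h2 : idom (conn a * gam g) = iran (conn b)^-1 by rewrite idom_mul // iran_inv db ib.
set x := conn a * gam g * (conn b)^-1.
have rx : rn x = a by apply: eps_inj; rewrite rnE iran_mul // iran_mul.
have dx : dm x = b by apply: eps_inj; rewrite dmE idom_mul // idom_inv.
have bx : to_base x = gam g.
  rewrite /to_base rx dx /x -!imulA -/(idom (conn b)) db ib -dg imul_idom imulA.
  by rewrite -/(idom (conn a)) h1 iran_imul.
by exists x; rewrite (coordE rx dx ia bx) ginvK.
Qed.

Lemma coord_inv x : coord x^-1 = star (coord x).
Proof.
have rx : rn x^-1 = dm x by apply: eps_inj; rewrite rnE dmE iran_inv.
have dx : dm x^-1 = rn x by apply: eps_inj; rewrite rnE dmE idom_inv.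
have bx : to_base x^-1 = (to_base x)^-1.
  by rewrite /to_base rx dx !iinvM iinvK imulA.
rewrite star_unit_mx (coordE rx dx (esym (blk_rn_dm x)) bx); congr (u _ _ _).
have [d1 r1] := to_base_ends x.
by apply: gam_inj; rewrite gam_inv gam_to_base gam_ginv ?idom_inv ?iran_inv.
Qed.

Lemma coord_mul x y : idom x = iran y -> coord (x * y) = (coord x * coord y)%R.
Proof.
move=> xy; have rdxy : rn y = dm x by apply: eps_inj; rewrite rnE dmE.
have rxy : rn (x * y) = rn x by apply: eps_inj; rewrite !rnE iran_mul.
have dxy : dm (x * y) = dm y by apply: eps_inj; rewrite !dmE idom_mul.
have by' : blk (dm x) = blk (rn x) by rewrite blk_rn_dm.
have bxy : to_base (x * y) = to_base x * to_base y.
  have [rd _] := connP (dm x).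
  rewrite /to_base rxy dxy rdxy !imulA.
  by rewrite -(imulA _ (conn (dm x))) -/(iran (conn (dm x))) rd dmE -(imulA _ x (idom x)) imul_idom.
rewrite (coordE rxy dxy (erefl _) bxy) (coordE rdxy (erefl _) by' (erefl _)).
rewrite unit_mx_mul ?dm_block //; congr (u _ _ _); apply: gam_inj.
have [d1 r1] := to_base_ends x; have [d2 r2] := to_base_ends y.
rewrite rdxy by' in d2 r2.
have c : idom (to_base x) = iran (to_base y) by rewrite d1 r2.
by rewrite gam_mul !gam_ginv ?(idom_mul c) ?(iran_mul c).
Qed.

Lemma coord_id a : coord (eps a) = idm a.
Proof.
have ia : idem (eps a) by apply/eps_idem; exists a.
have ra : rn (eps a) = a by apply: eps_inj; rewrite rnE iran_idem.
have da : dm (eps a) = a by apply: eps_inj; rewrite dmE idom_idem.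
have ba : to_base (eps a) = gam (1%g : G (blk a)).
  rewrite /to_base ra da gam_one; have [rr dr] := connP a.
  by rewrite -imulA -rr iran_imul -/(idom (conn a)) dr.
by rewrite (coordE ra da (erefl _) ba) ginvK (id_mxE _ _ disjX (blkP a)).
Qed.

Lemma eps_le a b : natle (eps a) (eps b) = (a <= b)%O.
Proof.
have ia c : idem (eps c) by apply/eps_idem; exists c.
rewrite leEmeet /natle idom_idem // (idem_comm (ia b) (ia a)) -eps_meet.
by rewrite (inj_eq eps_inj) eq_sym.
Qed.

Lemma coord_realization :
  exists R : {fset A * A}, [/\ partial_order R, ESN_conditions R, extends_order R,
    #|` B| = #|T| &
    exists phi : T -> A, [/\ injective phi,
      forall z, z \in elts (ESN R) <-> exists x, z = phi x &
      forall x y, phi (x * y) = (phi x * phi y)%R]].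
Proof.
have gb := nat_basis_groupoid K G coverX disjX.
have eo := transported_esn_order gb coord_inj coord_img coord_inv coord_mul.
have [po esn] := (esn_orderP _).1 eo.
exists (transported_order coord); split=> //.
- by move=> a b; rewrite -!coord_id transported_orderE ?eps_le //; exact: coord_inj.
- have -> : B = [fset coord x | x in T]%fset.
    apply/fsetP=> z; apply/idP/imfsetP => [/coord_img[x ->]|[x _ ->]]; first by exists x.
    exact: mem_coord.
  by rewrite card_imfset ?cardE //=; apply: coord_inj.
exists (fun x => down B (transported_order coord) (coord x)); split.
- exact: (transported_inj gb coord_inj coord_img coord_inv coord_mul).
- move=> z; split=> [/down_magmaP[_ /coord_img[x ->] ->]|[x ->]]; first by exists x.
  exact/mem_down_magma/mem_coord.
by move=> x y; rewrite (transported_mul gb coord_inj coord_img coord_inv coord_mul).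
Qed.

End Coordinates.

Section Realization.
Local Open Scope isg_scope.

(** The coordinates require choices: an element connecting each idempotent to
    its base point, and inverses of the maps [gam i]. *)
Theorem realization (K : fieldType) (d : Order.disp_t)
    (E : finMeetSemilatticeType d) (k : nat) (X : k.-tuple {set E})
    (G : 'I_k -> finGroupType) (T : invSemigroup) (eps : E -> T)
    (base : 'I_k -> E) (gam : forall i, G i -> T) :
  (forall a : E, exists i, a \in tnth X i) ->
  (forall i j (a : E), a \in tnth X i -> a \in tnth X j -> i = j) ->
  injective eps -> (forall e, idem e <-> exists a, e = eps a) ->
  {morph eps : a b / (a `&` b)%O >-> a * b} ->
  (forall a b, (exists i, a \in tnth X i /\ b \in tnth X i) <->
     exists x, iran x = eps a /\ idom x = eps b) ->
  (forall i, base i \in tnth X i) ->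
  (forall i, injective (@gam i)) ->
  (forall i (g h : G i), gam i (g * h)%g = gam i g * gam i h) ->
  (forall i x, idom x = eps (base i) /\ iran x = eps (base i) <->
     exists g : G i, x = gam i g) ->
  exists R : {fset blocks K X G * blocks K X G},
    [/\ partial_order R, ESN_conditions R, extends_order R,
    #|` nat_basis K X G| = #|T| &
    exists phi : T -> blocks K X G, [/\ injective phi,
      forall z, z \in elts (ESN R) <-> exists x, z = phi x &
      forall x y, phi (x * y) = (phi x * phi y)%R]].
Proof.
move=> coverX disjX eps_inj eps_idem eps_meet blockD baseX gam_inj gam_mul gam_img.
have [rn rnE] : {rn & forall x, eps (rn x) = iran x}.
  apply: (@choice _ _ (fun x a => eps a = iran x)) => x.
  by have [a ->] := (eps_idem _).1 (idem_iran x); exists a.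
have [dm dmE] : {dm & forall x, eps (dm x) = idom x}.
  apply: (@choice _ _ (fun x a => eps a = idom x)) => x.
  by have [a ->] := (eps_idem _).1 (idem_idom x); exists a.
have [blk blkP] := choice coverX.
have [conn connP] : {conn & forall a,
    iran (conn a) = eps a /\ idom (conn a) = eps (base (blk a))}.
  apply: (@choice _ _ (fun a x => iran x = eps a /\ idom x = eps (base (blk a)))) => a.
  by apply/blockD; exists (blk a).
pose ginv i x : G i := odflt 1%g [pick g : G i | gam i g == x].
have blk_rn_dm x : blk (rn x) = blk (dm x).
  have [i [rX dX]] : exists i, rn x \in tnth X i /\ dm x \in tnth X i.
    by apply/blockD; exists x; rewrite rnE dmE.
  by rewrite (disjX _ _ _ (blkP (rn x)) rX) (disjX _ _ _ (blkP (dm x)) dX).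
have ginvK i (g : G i) : ginv i (gam i g) = g.
  by rewrite /ginv; case: pickP => [h /eqP/gam_inj //|/(_ g)]; rewrite eqxx.
exact: (coord_realization K coverX disjX eps_inj eps_idem eps_meet gam_inj
  gam_mul gam_img rnE dmE blkP blk_rn_dm connP ginvK).
Qed.

End Realization.

(** * The semigroups constructed by the algorithm *)

Section Blocks.
Variables (d : Order.disp_t) (E : finMeetSemilatticeType d).
Variables (k : nat) (X : k.-tuple {set E}).
Hypothesis uniqX : uniq X.
Hypothesis partX : partition [set Y in tval X] [set: E].

Lemma block_mem i : tnth X i \in [set Y in tval X].
Proof. by rewrite inE mem_tnth. Qed.

Lemma block_cover a : exists i, a \in tnth X i.
Proof.
have : a \in cover [set Y in tval X] by rewrite (cover_partition partX) inE.
case/bigcupP=> Y; rewrite inE => /tnthP[i ->] aX; by exists i.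
Qed.

Lemma block_disjoint i j (a : E) : a \in tnth X i -> a \in tnth X j -> i = j.
Proof.
move=> aXi aXj; have [_ tX _] := and3P partX.
move/tuple_uniqP: uniqX; apply.
by rewrite -(def_pblock tX (block_mem i) aXi) -(def_pblock tX (block_mem j) aXj).
Qed.

Lemma block_pblock a b :
  (exists i, a \in tnth X i /\ b \in tnth X i) <->
  pblock [set Y in tval X] a = pblock [set Y in tval X] b.
Proof.
have [_ tX _] := and3P partX.
split=> [[i [aX bX]]|ab].
  by rewrite (def_pblock tX (block_mem i) aX) (def_pblock tX (block_mem i) bX).
have [i aX] := block_cover a; exists i; split=> //.
rewrite -(def_pblock tX (block_mem i) aX) ab mem_pblock.
by rewrite (cover_partition partX) inE.
Qed.

Lemma sorted_shape : sorted geq [seq #|Y| | Y : {set E} <- X] ->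
  shape_of [set Y in tval X] = [seq #|Y| | Y : {set E} <- X].
Proof.
move=> sX; rewrite /shape_of; apply: (sorted_eq (leT := geq)) => //.
- by move=> y x z /= yx zy; apply: leq_trans yx.
- by move=> x y; rewrite andbC; apply: anti_leq.
- by apply: sort_sorted => x y; apply: leq_total.
rewrite perm_sort; apply: perm_map; apply: uniq_perm; rewrite ?enum_uniq //.
by move=> Y; rewrite mem_enum inE.
Qed.

End Blocks.

Lemma geq_total : total geq.
Proof. by move=> x y; apply: leq_total. Qed.

Lemma shape_is_partition (d : Order.disp_t) (E : finMeetSemilatticeType d)
    (P : {set {set E}}) :
  partition P [set: E] -> is_partition #|E| (shape_of P).
Proof.
move=> pP; have [_ _ P0] := and3P pP.
have psh : perm_eq (shape_of P) [seq #|Y| | Y : {set E} <- enum P] by rewrite perm_sort.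
apply/andP; split; last exact: sort_sorted geq_total _.
apply/andP; split.
  rewrite (perm_all _ psh) all_map; apply/allP => Y; rewrite mem_enum => PY /=.
  by rewrite card_gt0; apply: contraNneq P0 => <-.
rewrite (perm_sumn psh) sumnE big_map big_enum /=.
by rewrite -(card_partition pP) cardsT.
Qed.

Section Candidates.
Variables (K : fieldType) (d : Order.disp_t) (sub : subroutines K d).

(** The nested loops amount to inserting the entries of this list one by one
    into an empty dictionary. *)
Definition candidates (n : nat) (E : finMeetSemilatticeType d) (lam : seq nat) :
    seq (named E) :=
  let Gn := Groups sub n in
  flatten [seq flatten [seq flatten [seq
      [seq ESN R | R <- GPosets sub X (group_at f)]
    | f <- GroupMaps sub X C Gn]
    | X <- DPartitions sub E lam]
    | C <- Compositions sub n lam].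

Lemma isgs_ofE n E lam :
  isgs_of sub n E lam = foldl (@insert K d sub E) [::] (candidates n E lam).
Proof.
rewrite /isgs_of /candidates -foldl_flatten; apply: eq_foldl => D C.
rewrite -foldl_flatten; apply: eq_foldl => {}D X.
rewrite -foldl_flatten; apply: eq_foldl => {}D f.
by rewrite -foldl_map.
Qed.

Definition valid (n : nat) (E : finMeetSemilatticeType d) (lam : seq nat)
    (S : named E) : Prop :=
  [/\ inverse_semigroup S, idempotents_are S, order_of S = n
    & exists2 P, D_partition_of S P & shape_of P = lam].

Lemma In_candidates n (E : finMeetSemilatticeType d) lam (S : named E) :
  List.In S (candidates n E lam) <->
  exists C X f (R : {fset blocks K X (group_at f) * blocks K X (group_at f)}),
    [/\ C \in Compositions sub n lam, X \in DPartitions sub E lam,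
        f \in GroupMaps sub X C (Groups sub n),
        R \in GPosets sub X (group_at f) & S = ESN R].
Proof.
split.
  case/In_flatten_map=> C /In_mem CC /In_flatten_map[X /In_mem XX].
  by case/In_flatten_map=> f /In_mem ff /In_map[R /In_mem RR <-]; exists C, X, f, R.
case=> C [X [f [R [CC XX ff RR ->]]]].
apply/In_flatten_map; exists C; first exact/In_mem.
apply/In_flatten_map; exists X; first exact/In_mem.
apply/In_flatten_map; exists f; first exact/In_mem.
by apply/In_map; exists R => //; apply/In_mem.
Qed.

(** The order is the number of basis matrices, that is the sum over the blocks
    of the squared size of the block times the order of its group; admissibility
    of [C] says that it is [n]. *)
Lemma candidates_valid n m (E : finMeetSemilatticeType d) lam (S : named E) :
  (0 < m)%N -> #|E| = m ->
  lam \in Partitions sub m ->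
  List.In S (candidates n E lam) -> valid n lam S.
Proof.
move=> m0 Em /(PartitionsP sub m).2 lamP.
case/In_candidates=> C [X [f [R [CC XX ff RR ->]]]].
have /(CompositionsP sub n m0 lamP).2 /and3P[C0 /eqP sC /eqP nE] := CC.
have [uX sX] := DPartitions_ordered XX.
have XX' : [set Y in tval X] \in [seq [set Y in tval X0] | X0 <- DPartitions sub E lam].
  exact: map_f.
have [DX shX] := ((DPartitionsP sub E lam).2 _).1 XX'.
have [partX _] := DX.
have fC := ((GroupMapsP sub X (Groups sub n) sC).2 f).1 ff.
have [po esn ext] := ((GPosetsP sub (group_at f) uX DX).2 R).1 RR.
have coverX := block_cover partX; have disjX := block_disjoint uX partX.
have gb := nat_basis_groupoid K (group_at f) coverX disjX.
have eo := (esn_orderP R).2 (conj po esn).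
have FP := @mem_idempotent_basis K d E _ X (group_at f).
have inj_idm := @id_mx_inj K d E _ X (group_at f) coverX disjX.
have [a _] : exists a : E, a \in [set: E].
  by apply/set0Pn; rewrite -card_gt0 cardsT Em.
have Fid b : id_mx K X (group_at f) b \in idempotent_basis K X (group_at f).
  by apply/FP; exists b.
split.
- apply: (down_inverse_semigroup gb eo); apply/fset0Pn.
  by exists (id_mx K X (group_at f) a); apply: (gb_sub gb).
- exact: (down_idempotents_are gb eo inj_idm FP ext).
- rewrite (order_down_magma gb eo) card_nat_basis; apply: etrans (esym nE).
  apply: eq_bigr => i _; rewrite fC; congr (_ ^ 2 * _)%N.
  have sizesX := etrans (esym (sorted_shape uX sX)) shX.
  rewrite -(congr1 (nth 0%N ^~ i) sizesX) (nth_map set0) ?size_tuple //.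
  by rewrite -tnth_nth.
exists [set Y in tval X] => //; split=> // b c.
rewrite (iff_sym (block_pblock partX b c)).
rewrite -(unit_mx_D_related K (group_at f) coverX disjX b c).
exact: iff_sym (down_D_related gb eo (Fid b) (Fid c)).
Qed.

End Candidates.

Section Insertion.
Variables (K : fieldType) (d : Order.disp_t) (sub : subroutines K d).
Variable E : finMeetSemilatticeType d.
Implicit Types (S T : named E) (D : dict (inv_type sub) (named E)).

Local Notation noniso := (fun S T : named E => ~ isomorphic S T).
Local Notation good S := (inverse_semigroup S /\ idempotents_are S).

Lemma insert_spec D S :
  good S -> (forall T, List.In T (contents D) -> good T) ->
  well_keyed (@Invariants K d sub E) D -> List.ForallOrdPairs noniso (contents D) ->
  [/\ well_keyed (@Invariants K d sub E) (insert D S),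
      List.ForallOrdPairs noniso (contents (insert D S)),
      forall T, List.In T (contents (insert D S)) -> T = S \/ List.In T (contents D),
      forall T, List.In T (contents D) -> List.In T (contents (insert D S)) &
      exists2 T, List.In T (contents (insert D S)) & isomorphic S T].
Proof.
move=> [isgS idS] goodD wkD nisoD; rewrite /insert.
have sym T : List.In T (contents D) -> isomorphic T S -> isomorphic S T.
  by move=> /goodD[isgT _]; apply: isomorphic_sym.
case: ifP => new; last first.
  split=> //; first by right.
  move: new; rewrite /IsNew; case lookupE: lookup => [l|//] /negbFE.
  case/In_has=> T lT /asboolP ST; exists T => //; apply/In_contents.
  by exists (Invariants sub S, l) => //; apply: lookup_In.
split.
- exact: append_well_keyed.
- apply: (append_pairwise (sim := fun S T : named E => isomorphic S T)) => //.
  + by move=> T /goodD[isgT idT]; apply: InvariantsP.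
  + move=> l T lookupE lT TS; move: new; rewrite /IsNew lookupE => /negP; apply.
    apply/In_has; exists T => //; apply/asboolP; apply: sym => //.
    apply/In_contents; exists (Invariants sub S, l) => //; exact: lookup_In.
  by move=> T _; apply: isomorphic_sym.
- by move=> T /In_append.
- by move=> T DT; apply/In_append; right.
by exists S; [apply/In_append; left|apply: isomorphic_refl].
Qed.

(** A semigroup is left out only when an isomorphic one is already present, and
    it is stored only when no entry under its key is isomorphic to it; entries
    under other keys cannot be. *)
Lemma foldl_insert_spec l :
  (forall S, List.In S l -> good S) ->
  let D := foldl (@insert K d sub E) [::] l in
  [/\ List.ForallOrdPairs noniso (contents D),
      forall S, List.In S (contents D) -> List.In S l &
      forall S, List.In S l -> exists2 T, List.In T (contents D) & isomorphic S T].
Proof.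
move=> goodl /=.
suff : let D := foldl (@insert K d sub E) [::] l in
  [/\ List.ForallOrdPairs noniso (contents D), well_keyed (@Invariants K d sub E) D,
      forall S, List.In S (contents D) -> List.In S l &
      forall S, List.In S l -> exists2 T, List.In T (contents D) & isomorphic S T].
  by case.
elim/last_ind: l goodl => [|l S IHl] goodl /=.
  by split=> //; constructor.
have Il T : List.In T l -> List.In T (rcons l S).
  by move=> lT; rewrite -cats1; apply/In_cat; left.
have IS : List.In S (rcons l S) by rewrite -cats1; apply/In_cat; right; left.
have [|nisoD wkD Dl lD] := IHl; first by move=> T /Il/goodl.
rewrite foldl_rcons; set D := foldl _ _ l in nisoD wkD Dl lD *.
have [wk' niso' D'P DD' [T D'T ST]] :=
  insert_spec (goodl S IS) (fun T DT => goodl T (Il T (Dl T DT))) wkD nisoD.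
split=> // [U /D'P[->|/Dl/Il]|U] //.
rewrite -cats1 => /In_cat[/lD[V /DD' D'V UV]|/= [<-|//]]; first by exists V.
by exists T.
Qed.

End Insertion.

(** * Every inverse semigroup is constructed *)

Section Completeness.
Variables (K : fieldType) (d : Order.disp_t) (sub : subroutines K d).
Variables (n : nat) (S : fmagma).
Hypotheses (isgS : inverse_semigroup S) (ordS : order_of S = n).

Local Notation T := (carrier_isg isgS).
Local Notation I := (idem_semilattice d T).

Lemma card_carrier : #|T| = n.
Proof. by rewrite -ordS /order_of -cardfE. Qed.

Lemma card_idem_bounds : (0 < #|I| <= n)%N.
Proof.
have [S0 _ _ _] := isgS; have /fset0Pn[x Sx] := S0.
apply/andP; split.
  apply/card_gt0P; exists (exist _ (idom ([` Sx]%fset : T)) (idem_idom _)) => //.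
by rewrite -card_carrier (leq_card (val : I -> T)) //; apply: val_inj.
Qed.

(* The idempotents of [S], renamed as the elements of a semilattice [E]. *)
Section Renamed.
Variables (E : finMeetSemilatticeType d) (eps : E -> T).
Hypothesis eps_inj : injective eps.
Hypothesis eps_idem : forall e : T, idem e <-> exists a, e = eps a.
Hypothesis eps_meet : {morph eps : a b / (a `&` b)%O >-> imul a b}.

Definition D_rel (a b : E) : bool :=
  [exists x : T, (iran x == eps a) && (idom x == eps b)].

Lemma D_relP a b : reflect (exists x : T, iran x = eps a /\ idom x = eps b) (D_rel a b).
Proof.
apply: (iffP existsP) => [[x /andP[/eqP xa /eqP xb]]|[x [xa xb]]].
  by exists x.
by exists x; rewrite xa xb !eqxx.
Qed.

Lemma eps_is_idem a : idem (eps a).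
Proof. by apply/eps_idem; exists a. Qed.

Lemma D_rel_refl a : D_rel a a.
Proof. by apply/D_relP; exists (eps a); rewrite iran_idem ?idom_idem // eps_is_idem. Qed.

Lemma D_rel_sym a b : D_rel a b = D_rel b a.
Proof.
suff imp x y : D_rel x y -> D_rel y x by apply/idP/idP; apply: imp.
by case/D_relP=> z [rz dz]; apply/D_relP; exists (iinv z); rewrite iran_inv idom_inv.
Qed.

Lemma D_rel_trans : transitive D_rel.
Proof.
move=> b a c /D_relP[x [rx dx]] /D_relP[y [ry dy]]; apply/D_relP.
by exists (imul x y); rewrite iran_mul ?idom_mul ?dx ?ry.
Qed.

Lemma D_rel_equiv : {in [set: E] & &, equivalence_rel D_rel}.
Proof.
move=> a b c _ _ _; split=> [|ab]; first exact: D_rel_refl.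
apply/idP/idP; apply: D_rel_trans => //; by rewrite D_rel_sym.
Qed.

Definition D_blocks := equivalence_partition D_rel [set: E].

Lemma D_blocks_partition : partition D_blocks [set: E].
Proof. exact: (equivalence_partitionP D_rel_equiv). Qed.

Lemma D_blocksE a b : (pblock D_blocks a == pblock D_blocks b) = D_rel a b.
Proof.
have [_ tD _] := and3P D_blocks_partition.
rewrite eq_pblock ?(cover_partition D_blocks_partition) ?inE //.
by rewrite (pblock_equivalence_partition D_rel_equiv) ?inE.
Qed.

(** Conjugation by [x] sends the idempotents below [x x^-1] to the idempotents
    below [x^-1 x], and each to one in the same D-class. *)
Lemma D_blocks_D_partition : D_partition D_blocks.
Proof.
split=> [|e1 e2 f e12 fe]; first exact: D_blocks_partition.
have cardE e : #|[set h | (h <= e)%O && (pblock D_blocks h == pblock D_blocks f)]| =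
    #|[set h | (h <= e)%O && D_rel h f]|.
  by apply: eq_card => h; rewrite !inE D_blocksE.
rewrite !cardE.
have {}e12 : D_rel e1 e2 by rewrite -D_blocksE e12.
suff le a b : D_rel a b ->
    (#|[set h | (h <= a)%O && D_rel h f]| <= #|[set h | (h <= b)%O && D_rel h f]|)%N.
  by apply/eqP; rewrite eqn_leq !le // D_rel_sym.
case/D_relP=> x [rx dx].
have [c cE] : {c & forall h, eps (c h) = imul (imul (iinv x) (eps h)) x}.
  apply: (@choice _ _ (fun h g => eps g = imul (imul (iinv x) (eps h)) x)) => h.
  have /eps_idem[g ->] := idem_conj x (eps_is_idem h).
  by exists g.
have eps_leE := eps_le eps_inj eps_idem eps_meet.
rewrite -(card_in_imset (f := c)).
  apply/subset_leq_card/subsetP=> _ /imsetP[h + ->]; rewrite !inE => /andP[ha hf].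
  rewrite -eps_leE cE -dx; apply/andP; split.
    apply/natle_idemlP; exists (imul (imul (iinv x) (eps h)) x).
      exact/idem_conj/eps_is_idem.
    by rewrite -[RHS]imulA imul_idom.
  apply: D_rel_trans hf; rewrite D_rel_sym; apply/D_relP.
  exists (imul (eps h) x); rewrite cE iran_corestr ?eps_is_idem ?rx ?eps_leE //.
  split=> //; rewrite /idom iinvM (idem_inv (eps_is_idem h)) !imulA.
  by rewrite -(imulA _ (eps h) (eps h)) (eqP (eps_is_idem h)).
have cK h : (h <= a)%O -> imul (imul x (eps (c h))) (iinv x) = eps h.
  rewrite -eps_leE -rx => hx; rewrite cE !imulA -/(iran x) -imulA -/(iran x).
  rewrite -(natle_idem (eps_is_idem h) hx).
  by rewrite (idem_comm (eps_is_idem h) (idem_iran x)) -(natle_idem (eps_is_idem h) hx).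
move=> h h'; rewrite !inE => /andP[ha _] /andP[ha' _] chh'.
by apply: eps_inj; rewrite -(cK h) // -(cK h') // chh'.
Qed.

(** The maximal subgroup at [eps a] has at most [n] elements, so that it has a
    representative in the list of groups. *)
Lemma exists_group a : exists j : 'I_(size (Groups sub n)),
  exists gam : nth ({perm void} : finGroupType) (Groups sub n) j -> T,
  [/\ injective gam, forall g h, gam (g * h)%g = imul (gam g) (gam h) &
      forall x, idom x = eps a /\ iran x = eps a <-> exists g, x = gam g].
Proof.
pose H := max_subgroup_group (eps_is_idem a).
have cardH : (#|H| <= n)%N.
  by rewrite -card_carrier (leq_card (val : H -> T)) //; apply: val_inj.
have [_ _ /(_ H cardH)[G GIn]] := GroupsP sub n.
have [j <-] := In_nth ({perm void} : finGroupType) GIn.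
rewrite isog_sym => /isogP[phi inj_phi im_phi]; exists j.
exists (fun g => val (phi g)); split.
- by move=> g h /val_inj/(injmP inj_phi); apply; rewrite inE.
- by move=> g h; rewrite morphM ?inE.
move=> x; split=> [[dx rx]|[g ->]]; last exact: max_subgroupP.
have px : in_max_subgroup (eps a) x by rewrite /in_max_subgroup dx rx !eqxx.
have : (exist _ x px : H) \in (phi @* [set: _])%g by rewrite im_phi inE.
by case/morphimP=> g _ _ xg; exists g; rewrite -xg.
Qed.

(** The loops reach [S] at the shape of its D-classes, their maximal subgroups,
    and the natural order transported to the matrices. *)
Lemma exists_candidate : (0 < #|E|)%N ->
  exists2 lam, lam \in Partitions sub #|E| &
  exists2 S' : named E, List.In S' (candidates sub n E lam) & isomorphic S S'.
Proof.
move=> E0; set lam := shape_of D_blocks.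
have lamP : is_partition #|E| lam := shape_is_partition D_blocks_partition.
exists lam; first by apply/(PartitionsP sub #|E|).2.
have /mapP[X XX DX] : D_blocks \in [seq [set Y in tval X] | X <- DPartitions sub E lam].
  by apply/(DPartitionsP sub E lam).2; split=> //; apply: D_blocks_D_partition.
have [uX sX] := DPartitions_ordered XX.
have partX : partition [set Y in tval X] [set: E] by rewrite -DX; apply: D_blocks_partition.
have coverX := block_cover partX; have disjX := block_disjoint uX partX.
have [base baseX] : {base & forall i, base i \in tnth X i}.
  apply: (@choice _ _ (fun i a => a \in tnth X i)) => i; apply/set0Pn.
  by have [_ _] := and3P partX; apply: contraNneq => <-; apply: block_mem.
have [j jP] := choice (fun i => exists_group (base i)).
pose f := [ffun i => j i] : {ffun 'I_(size lam) -> 'I_(size (Groups sub n))}.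
have gamP i : exists gam : group_at f i -> T,
  [/\ injective gam, forall g h, gam (g * h)%g = imul (gam g) (gam h) &
      forall x, idom x = eps (base i) /\ iran x = eps (base i) <-> exists g, x = gam g].
  by rewrite /group_at ffunE; apply: jP.
pose gam i := projT1 (cid (gamP i)).
have gam_inj i : injective (gam i) by rewrite /gam; case: cid => ? [].
have gam_mul i (g h : group_at f i) : gam i (g * h)%g = imul (gam i g) (gam i h).
  by rewrite /gam; case: cid => ? [].
have gam_img i (x : T) : idom x = eps (base i) /\ iran x = eps (base i) <->
    exists g, x = gam i g.
  by rewrite /gam; case: cid => ? [].
have blockD a b : (exists i, a \in tnth X i /\ b \in tnth X i) <->
    exists x : T, iran x = eps a /\ idom x = eps b.
  rewrite (block_pblock partX) -DX; split=> [/eqP|/D_relP ab].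
    by rewrite D_blocksE => /D_relP.
  by apply/eqP; rewrite D_blocksE.
have [R [po esn ext cardB [phi [inj_phi im_phi mor_phi]]]] := realization K
  coverX disjX eps_inj eps_idem eps_meet blockD baseX gam_inj gam_mul gam_img.
pose C := [tuple #|group_at f i| | i < size lam].
have CE (i : 'I_(size lam)) : nth 0%N C i = #|group_at f i| by rewrite -tnth_nth tnth_mktuple.
exists (ESN R).
  apply/In_candidates; exists (tval C), X, f, R; split=> //.
  - apply/(CompositionsP sub n E0 lamP).2/and3P; split.
    + by apply/allP=> c /tnthP[i ->]; rewrite tnth_mktuple; apply/card_gt0P; exists 1%g.
    + by rewrite size_tuple.
    rewrite -card_carrier -cardB card_nat_basis; apply/eqP/eq_bigr => i _.
    rewrite CE; congr (_ ^ 2 * _)%N.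
    have sizesX : [seq #|Y| | Y : {set E} <- X] = lam by rewrite -(sorted_shape uX sX) -DX.
    rewrite -(congr1 (nth 0%N ^~ i) sizesX) (nth_map set0) ?(size_tuple X) //.
    by rewrite -tnth_nth.
  - apply: ((GroupMapsP sub X (Groups sub n) (size_tuple C)).2 f).2 => i.
    by rewrite CE.
  apply: ((GPosetsP sub (group_at f) uX _).2 R).2 => //.
  by rewrite -DX; apply: D_blocks_D_partition.
(* Off the carrier of [S] the value [0] is arbitrary. *)
pose Phi (x : ambient S) : blocks K X (group_at f) := oapp phi 0%R (insub x : option (elts S)).
have PhiE x (Sx : x \in elts S) : Phi x = phi [` Sx]%fset.
  rewrite /Phi insubT /=; congr phi; exact: val_inj.
have [_ cl _ _] := isgS.
exists Phi; split.
- by move=> x y Sx Sy; rewrite (PhiE x Sx) (PhiE y Sy) => /inj_phi/(congr1 val).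
- apply/fsetP=> z; apply/imfsetP/idP => [[x Sx ->]|/im_phi[x ->]].
    by apply/im_phi; exists [` Sx]%fset; rewrite PhiE.
  by exists (val x); [apply: valP|rewrite (PhiE _ (valP x)); congr phi; apply: val_inj].
move=> x y Sx Sy; rewrite (PhiE x Sx) (PhiE y Sy) (PhiE _ (cl _ _ Sx Sy)).
by rewrite /= -mor_phi; congr phi; apply: val_inj.
Qed.

End Renamed.

Theorem completeness :
  exists m (E : finMeetSemilatticeType d) lam (S' : named E),
    [/\ m \in iota 1 n, List.In E (MeetSemilattices sub m),
        lam \in Partitions sub m, List.In S' (candidates sub n E lam)
      & isomorphic S S'].
Proof.
have /andP[I0 In] := card_idem_bounds.
have [cardMS _ MS] := MeetSemilatticesP sub I0.
have [E EIn [phi bij_phi mor_phi]] := MS I erefl.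
have cardE := cardMS E EIn; have [psi phiK psiK] := bij_phi.
pose eps (a : E) : T := val (psi a).
have eps_inj : injective eps by move=> a b /val_inj/(can_inj psiK).
have eps_idem (e : T) : idem e <-> exists a, e = eps a.
  split=> [ie|[a ->]]; last exact: (valP (psi a)).
  by exists (phi (exist _ e ie)); rewrite /eps phiK.
have eps_meet : {morph eps : a b / (a `&` b)%O >-> imul a b}.
  move=> a b; rewrite /eps; suff -> : psi (a `&` b)%O = (psi a `&` psi b)%O by [].
  by apply: (can_inj phiK); rewrite mor_phi !psiK.
have E0 : (0 < #|E|)%N by rewrite cardE.
have [lam lamIn [S' S'In SS']] := exists_candidate eps_inj eps_idem eps_meet E0.
exists #|I|, E, lam, S'; split=> //; last by rewrite -cardE.
by rewrite mem_iota I0 add1n ltnS.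
Qed.

End Completeness.

(** * The output of the algorithm *)

(** The semilattice and the shape that a semigroup was built from can be read
    off from it. *)
Lemma valid_iso (n n' : nat) (d : Order.disp_t) (E E' : finMeetSemilatticeType d)
    lam lam' (S : named E) (S' : named E') :
  valid n lam S -> valid n' lam' S' -> isomorphic S S' ->
  semilattice_iso E E' /\ lam = lam'.
Proof.
case=> isgS idS _ [P DP <-] [isgS' idS' _ [P' DP' <-]].
exact: (isomorphic_invariants isgS isgS' idS idS' DP DP').
Qed.

Section Output.
Variables (K : fieldType) (d : Order.disp_t) (sub : subroutines K d) (n : nat).

Lemma isgs_of_spec m (E : finMeetSemilatticeType d) lam : (0 < m)%N -> #|E| = m ->
  lam \in Partitions sub m ->
  let D := contents (isgs_of sub n E lam) in
  [/\ List.ForallOrdPairs (fun S T : named E => ~ isomorphic S T) D,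
      forall S, List.In S D -> valid n lam S &
      forall S, List.In S (candidates sub n E lam) ->
        exists2 T, List.In T D & isomorphic S T].
Proof.
move=> m0 Em lamIn /=; rewrite isgs_ofE.
have [|niso Dl lD] := @foldl_insert_spec K d sub E (candidates sub n E lam).
  by move=> S /(candidates_valid m0 Em lamIn)[].
by split=> // S /Dl/(candidates_valid m0 Em lamIn).
Qed.

Lemma iota_MS m E : m \in iota 1 n -> List.In E (MeetSemilattices sub m) ->
  (0 < m)%N /\ #|E| = m.
Proof.
rewrite mem_iota => /andP[m0 _] EIn.
by have [cardMS _ _] := MeetSemilatticesP sub m0; split=> //; apply: cardMS.
Qed.

Lemma In_enumeration S : List.In S (enumeration sub n) <->
  exists m (E : finMeetSemilatticeType d) lam (S' : named E),
    [/\ m \in iota 1 n, List.In E (MeetSemilattices sub m),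
        lam \in Partitions sub m, List.In S' (contents (isgs_of sub n E lam))
      & S = S'].
Proof.
split.
  case/In_flatten_map=> m /In_mem mIn /In_flatten_map[E EIn].
  case/In_flatten_map=> lam /In_mem lamIn /In_map[S' S'In <-].
  by exists m, E, lam, S'.
case=> m [E [lam [S' [mIn EIn lamIn S'In ->]]]].
apply/In_flatten_map; exists m; first exact/In_mem.
apply/In_flatten_map; exists E => //.
apply/In_flatten_map; exists lam; first exact/In_mem.
by apply/In_map; exists S'.
Qed.

Lemma enumeration_sound S : List.In S (enumeration sub n) ->
  inverse_semigroup S /\ order_of S = n.
Proof.
case/In_enumeration=> m [E [lam [S' [mIn EIn lamIn S'In ->]]]].
have [m0 Em] := iota_MS mIn EIn.
have [_ /(_ S' S'In)[isgS' _ ordS' _] _] := isgs_of_spec m0 Em lamIn.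
by [].
Qed.

(** Within one dictionary this is the comparison made before each insertion.
    Across dictionaries, the number of idempotents, their semilattice or the
    sizes of their D-classes differ. *)
Lemma enumeration_irredundant :
  List.ForallOrdPairs (fun S T => ~ isomorphic S T) (enumeration sub n).
Proof.
apply: (@ForallOrdPairs_flatten _ _ (fun m m' => m <> m')).
- by apply: uniq_ForallOrdPairs; apply: iota_uniq.
- move=> m /In_mem mIn; have m0 : (0 < m)%N by move: mIn; rewrite mem_iota => /andP[].
  have [_ MSpairs _] := MeetSemilatticesP sub m0.
  apply: ForallOrdPairs_flatten MSpairs _ _ => [E EIn|E E' EIn E'In niso S S'].
    have [_ Em] := iota_MS mIn EIn.
    apply: (@ForallOrdPairs_flatten _ _ (fun lam lam' => lam <> lam')).
    + by apply: uniq_ForallOrdPairs; have [] := PartitionsP sub m.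
    + move=> lam /In_mem lamIn; apply: ForallOrdPairs_map.
      by have [] := isgs_of_spec m0 Em lamIn.
    move=> lam lam' /In_mem lamIn /In_mem lamIn' neq _ _ /In_map[S SIn <-] /In_map[S' S'In <-].
    have [_ /(_ S SIn) vS _] := isgs_of_spec m0 Em lamIn.
    have [_ /(_ S' S'In) vS' _] := isgs_of_spec m0 Em lamIn'.
    by case/(valid_iso vS vS').
  have [_ Em] := iota_MS mIn EIn; have [_ Em'] := iota_MS mIn E'In.
  case/In_flatten_map=> lam /In_mem lamIn /In_map[{}S SIn <-].
  case/In_flatten_map=> lam' /In_mem lamIn' /In_map[{}S' S'In <-].
  have [_ /(_ S SIn) vS _] := isgs_of_spec m0 Em lamIn.
  have [_ /(_ S' S'In) vS' _] := isgs_of_spec m0 Em' lamIn'.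
  by case/(valid_iso vS vS').
move=> m m' /In_mem mIn /In_mem mIn' neq S S'.
case/In_flatten_map=> E EIn /In_flatten_map[lam /In_mem lamIn /In_map[{}S SIn <-]].
case/In_flatten_map=> E' EIn' /In_flatten_map[lam' /In_mem lamIn' /In_map[{}S' S'In <-]].
have [m0 Em] := iota_MS mIn EIn; have [m0' Em'] := iota_MS mIn' EIn'.
have [_ /(_ S SIn) vS _] := isgs_of_spec m0 Em lamIn.
have [_ /(_ S' S'In) vS' _] := isgs_of_spec m0' Em' lamIn'.
case/(valid_iso vS vS') => -[phi bij_phi _] _; apply: neq.
by rewrite -Em -Em'; apply: bij_eq_card bij_phi.
Qed.

Lemma enumeration_complete S : inverse_semigroup S -> order_of S = n ->
  exists T, List.In T (enumeration sub n) /\ isomorphic S T.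
Proof.
move=> isgS ordS; have [m [E [lam [S' [mIn EIn lamIn S'In SS']]]]] := completeness sub isgS ordS.
have [m0 Em] := iota_MS mIn EIn.
have [_ _ /(_ S' S'In)[T TIn S'T]] := isgs_of_spec m0 Em lamIn.
exists (magma_of T); split; last exact: isomorphic_trans SS' S'T.
by apply/In_enumeration; exists m, E, lam, T.
Qed.

End Output.

Unset Implicit Arguments.

Theorem theorem3p5 (R : realType) (d : Order.disp_t)
    (sub : subroutines (complex R) d) (n : nat) (hn : (0 < n)%N) :
  (forall S : fmagma, List.In S (enumeration sub n) ->
     inverse_semigroup S /\ order_of S = n) /\
  List.ForallOrdPairs (fun S T : fmagma => ~ isomorphic S T)
    (enumeration sub n) /\
  (forall S : fmagma, inverse_semigroup S -> order_of S = n ->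
     exists T : fmagma, List.In T (enumeration sub n) /\ isomorphic S T).
Proof.
split; first exact: enumeration_sound.
split; first exact: enumeration_irredundant.
exact: enumeration_complete.
Qed.
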